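(* Let $K$ be a field and let $(X,\sigma)$ be a Deaconu--Renault system with $X$ totally disconnected. The following are equivalent: (1) $X$ is discrete and $\sigma$ has no eventually periodic points; (2) $A_K(G(X,\sigma))$ is categorically Artinian; (3) $A_K(G(X,\sigma))$ is locally Artinian.
   Context: A Deaconu--Renault system is a pair $(X,\sigma)$ where $X$ is a locally compact Hausdorff space and $\sigma:\operatorname{dom}(\sigma)\to X$ is a local homeomorphism defined on an open subset $\operatorname{dom}(\sigma)\subseteq X$. Set $\operatorname{dom}(\sigma^0)=X$, $\sigma^0=\mathrm{id}_X$, $\operatorname{dom}(\sigma^{n+1})=\{x\in\operatorname{dom}(\sigma^n):\sigma^n(x)\in\operatorname{dom}(\sigma)\}$ and $\sigma^{n+1}(x)=\sigma(\sigma^n(x))$. A point $x\in X$ is eventually periodic if there are $m\ge0$ and $p\ge1$ with $x\in\operatorname{dom}(\sigma^{m+p})$ and $\sigma^{m+p}(x)=\sigma^m(x)$. The Deaconu--Renault groupoid is $G(X,\sigma)=\{(x,k,y)\in X\times\mathbb Z\times X:\exists\, m,n\ge0,\ k=m-n,\ x\in\operatorname{dom}(\sigma^m),\ y\in\operatorname{dom}(\sigma^n),\ \sigma^m(x)=\sigma^n(y)\}$, with $r(x,k,y)=x$, $s(x,k,y)=y$, $(x,k,y)(y,\ell,z)=(x,k+\ell,z)$, $(x,k,y)^{-1}=(y,-k,x)$, unit space identified with $X$ via $x\leftrightarrow(x,0,x)$, and topology generated by the sets $Z(U,m,n,V)=\{(x,m-n,y): x\in U,\ y\in V,\ \sigma^m(x)=\sigma^n(y)\}$,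 with $m,n\ge0$ and $U\subseteq\operatorname{dom}(\sigma^m)$, $V\subseteq\operatorname{dom}(\sigma^n)$ open such that $\sigma^m|_U$, $\sigma^n|_V$ are homeomorphisms onto their images. When $X$ is totally disconnected this is an ample Hausdorff groupoid. The Steinberg algebra of an ample Hausdorff groupoid $G$ is $A_K(G)=\mathrm{span}_K\{1_U:U\subseteq G\text{ a compact open bisection}\}$ with convolution product, determined by $1_U*1_V=1_{UV}$ (a bisection is a set on which $r$ and $s$ are injective); it is a ring with local units. For a ring $R$ with local units: $R$ is categorically Artinian if every finitely generated (unital, i.e. $RM=M$) left $R$-module $M$ is Artinian; $R$ is locally Artinian if for every finite subset $S\subseteq R$ there is an idempotent $e\in R$ with $S\subseteq eRe$ and $eRe$ left Artinian. (Left and right versions are equivalent for $A_K(G)$, since inversion in $G$ induces an anti-automorphism.) *)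

(* Defs.v *)
From HB Require Import structures.
From mathcomp Require Import all_boot all_order all_algebra.
From mathcomp Require Import boolp classical_sets functions cardinality fsbigop.
From mathcomp Require Import topology numfun.

Set Implicit Arguments.
Unset Strict Implicit.
Unset Printing Implicit Defensive.

Import GRing.Theory.

Local Open Scope classical_set_scope.
Local Open Scope ring_scope.

(** * Deaconu-Renault systems *)

Definition discrete_space (X : topologicalType) := forall A : set X, open A.

Definition homeo_onto_image (X : topologicalType) (U : set X) (f : X -> X) :=
  exists g : X -> X, [/\ {in U, cancel f g},
    {within U, continuous f} & {within f @` U, continuous g}].

Definition local_homeo_on (X : topologicalType) (D : set X) (f : X -> X) :=
  forall x, D x -> exists U : set X,
    [/\ open U, U x, U `<=` D, open (f @` U) & homeo_onto_image U f].

(* The partial map is a total function dr_map together with its domain dr_dom;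
   the values of dr_map outside dr_dom are never used. *)
Record DRsystem (X : topologicalType) := {
  dr_dom : set X;
  dr_map : X -> X;
  dr_locally_compact : locally_compact [set: X];
  dr_hausdorff : hausdorff_space X;
  dr_dom_open : open dr_dom;
  dr_local_homeo : local_homeo_on dr_dom dr_map
}.

Fixpoint iter_dom (X : topologicalType) (S : DRsystem X) (n : nat) : set X :=
  if n is n'.+1 then
    [set x | iter_dom S n' x /\ dr_dom S (iter n' (dr_map S) x)]
  else [set: X].

Definition eventually_periodic (X : topologicalType) (S : DRsystem X) (x : X) :=
  exists m p : nat, [/\ (1 <= p)%N, iter_dom S (m + p)%N x &
    iter (m + p)%N (dr_map S) x = iter m (dr_map S) x].

(** * Topological groupoids and their Steinberg algebras *)

(* The partial composition is given by its graph: gprod a b c reads "a and b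
   are composable and ab = c". Only the data entering the definition of the
   Steinberg algebra are recorded. *)
Record groupoidData := GroupoidData {
  garrow :> topologicalType;
  gobj : Type;
  grange : garrow -> gobj;
  gsource : garrow -> gobj;
  gprod : garrow -> garrow -> garrow -> Prop
}.

Definition compact_open_bisection (G : groupoidData) (U : set G) :=
  [/\ compact U, open U, {in U &, injective (@grange G)} &
      {in U &, injective (@gsource G)}].

(* (f * g)(c) is the sum of f(a) g(b) over all factorisations ab = c. For f and
   g in the Steinberg algebra only finitely many terms are nonzero (the library
   gives the value 0 to sums with infinite support). *)
Definition convolution (K : fieldType) (G : groupoidData) (f g : G -> K) :
    G -> K :=
  fun c => \sum_(p \in [set p : G * G | gprod p.1 p.2 c]) (f p.1 * g p.2).

Definition is_subspace (K : fieldType) (T : Type) (W : set (T -> K)) :=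
  W (fun=> 0) /\
  forall (k : K) (f g : T -> K), W f -> W g -> W (fun x => k * f x + g x).

Definition linear_span (K : fieldType) (T : Type) (B : set (T -> K)) :
    set (T -> K) :=
  smallest (@is_subspace K T) B.

(** * Rings without unit, their modules and chain conditions *)

(* A not necessarily unital ring presented as a set of elements of an ambient
   additive group carrying a product; for the rings considered below this set
   is closed under subtraction and product. *)
Record rngData := RngData {
  rambient : zmodType;
  rmul : rambient -> rambient -> rambient;
  relem : set rambient
}.

Arguments relem : clear implicits.

Definition is_subgroup (M : zmodType) (N : set M) :=
  N 0 /\ forall x y, N x -> N y -> N (x - y).

Definition dcc (T : Type) (P : set T -> Prop) :=
  forall I : nat -> set T, (forall n, P (I n)) ->
    (forall n, I n.+1 `<=` I n) ->
  exists n0, forall n, (n0 <= n)%N -> I n = I n0.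

Definition left_ideal (R : rngData) (I : set (rambient R)) :=
  [/\ I `<=` relem R, is_subgroup I &
      forall a x, relem R a -> I x -> I (rmul a x)].

Definition left_artinian (R : rngData) := dcc (@left_ideal R).

(* act is only constrained, and only used, on scalars belonging to R. *)
Record left_module (R : rngData) (M : zmodType)
    (act : rambient R -> M -> M) : Prop := {
  act_addl : forall a b x, relem R a -> relem R b ->
    act (a + b) x = act a x + act b x;
  act_addr : forall a x y, relem R a -> act a (x + y) = act a x + act a y;
  act_mul : forall a b x, relem R a -> relem R b ->
    act (rmul a b) x = act a (act b x)
}.

Definition submodule (R : rngData) (M : zmodType)
    (act : rambient R -> M -> M) (N : set M) :=
  is_subgroup N /\ forall a x, relem R a -> N x -> N (act a x).

(* RM = M, where RM is the additive subgroup generated by the products ax *)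
Definition unital_module (R : rngData) (M : zmodType)
    (act : rambient R -> M -> M) :=
  smallest (@is_subgroup M)
    [set y | exists a x, relem R a /\ y = act a x] = [set: M].

Definition finitely_generated (R : rngData) (M : zmodType)
    (act : rambient R -> M -> M) :=
  exists B : set M, finite_set B /\ smallest (submodule act) B = [set: M].

Definition artinian_module (R : rngData) (M : zmodType)
    (act : rambient R -> M -> M) := dcc (submodule act).

Definition categorically_artinian (R : rngData) :=
  forall (M : zmodType) (act : rambient R -> M -> M),
    left_module act -> unital_module act -> finitely_generated act ->
    artinian_module act.

Definition corner (R : rngData) (e : rambient R) : rngData :=
  RngData (@rmul R) [set rmul (rmul e a) e | a in relem R].

Definition locally_artinian (R : rngData) :=
  forall B : set (rambient R), finite_set B -> B `<=` relem R ->
  exists e : rambient R, [/\ relem R e, rmul e e = e,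
    B `<=` relem (corner e) & left_artinian (corner e)].

Definition steinberg_algebra (K : fieldType) (G : groupoidData) : rngData :=
  @RngData (G -> K) (@convolution K G)
    (linear_span [set (\1_U : G -> K) | U in @compact_open_bisection G]).

(** * The Deaconu-Renault groupoid *)

Definition dr_rel (X : topologicalType) (S : DRsystem X) (g : X * int * X) :=
  exists m n : nat, [/\ g.1.2 = m%:Z - n%:Z, iter_dom S m g.1.1,
    iter_dom S n g.2 & iter m (dr_map S) g.1.1 = iter n (dr_map S) g.2].

Definition dr_arrow (X : topologicalType) (S : DRsystem X) : Type :=
  {g : X * int * X | `[< dr_rel S g >]}.

Definition dr_range (X : topologicalType) (S : DRsystem X) (g : dr_arrow S) :
  X := (val g).1.1.

Definition dr_degree (X : topologicalType) (S : DRsystem X) (g : dr_arrow S) :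
  int := (val g).1.2.

Definition dr_source (X : topologicalType) (S : DRsystem X) (g : dr_arrow S) :
  X := (val g).2.

(* (x, k, y) (y', l, z) is defined when y = y', and is then (x, k + l, z). *)
Definition dr_prod (X : topologicalType) (S : DRsystem X)
    (a b c : dr_arrow S) :=
  dr_source a = dr_range b /\
  val c = (dr_range a, dr_degree a + dr_degree b, dr_source b).

Definition dr_Z (X : topologicalType) (S : DRsystem X)
    (U : set X) (m n : nat) (V : set X) : set (dr_arrow S) :=
  [set g | [/\ U (dr_range g), V (dr_source g), dr_degree g = m%:Z - n%:Z &
    iter m (dr_map S) (dr_range g) = iter n (dr_map S) (dr_source g)]].

Definition dr_subbase (X : topologicalType) (S : DRsystem X) :
    set (set (dr_arrow S)) :=
  [set A | exists (U V : set X) (m n : nat),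
    [/\ open U /\ open V, U `<=` iter_dom S m /\ V `<=` iter_dom S n,
        homeo_onto_image U (iter m (dr_map S)),
        homeo_onto_image V (iter n (dr_map S)) &
        A = @dr_Z X S U m n V]].

HB.instance Definition _ (X : topologicalType) (S : DRsystem X) :=
  Choice.on (dr_arrow S).

HB.instance Definition _ (X : topologicalType) (S : DRsystem X) :=
  isSubBaseTopological.Build (dr_arrow S) (@dr_subbase X S) id.

Definition dr_groupoid (X : topologicalType) (S : DRsystem X) : groupoidData :=
  @GroupoidData (dr_arrow S) X (@dr_range X S) (@dr_source X S) (@dr_prod X S).

(* Main.v *)
Require Import Defs.
From HB Require Import structures.
From mathcomp Require Import all_boot all_order all_algebra.
From mathcomp Require Import finmap zify.
From mathcomp Require Import boolp classical_sets topology.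
From mathcomp Require Import functions cardinality fsbigop numfun.
Import GRing.Theory.

(** Write G for the Deaconu-Renault groupoid and A for its Steinberg algebra.

    (1) implies (2). If X is discrete then so is G, so A is the space of
    finitely supported functions on G, spanned by point masses. If moreover no
    point is eventually periodic then G has trivial isotropy, and A is a direct
    sum of algebras of finitary matrices. Concretely, when e is the point mass
    at a unit x, every nonzero element of A e can be multiplied on the left back
    to e (unit_minimal), so A e is a minimal left ideal and each vector of the
    form e y in a module generates a submodule that is simple or zero. A unital
    module is spanned by such vectors, a finitely generated one by finitely many
    of them, and the chain condition follows by induction on their number
    (span_chain_stable).

    (2) implies (3). A has local units: every finite subset of A is contained in
    e A e for e the indicator of a compact open set of units. If I is a left
    ideal of e A e, the elements x of A e such that e A x is contained in I form
    a submodule of A e from which I is recovered as its intersection with e A e;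
    so chains in e A e are controlled by chains of submodules of the cyclic
    module A e (corner_left_artinian).

    (3) implies (1). Suppose that h_0, h_1, ... are elements fixed on both sides
    by one element b, such that each is a left multiple of the previous one. In
    a locally Artinian ring the left ideals they generate inside a corner
    containing b stabilise, so some h_n is a left multiple of h_(n+1)
    (locally_artinian_chain). If x is not isolated, apply this to the indicators
    of a strictly decreasing sequence of compact open neighbourhoods of x: the
    conclusion fails at any unit in the nth neighbourhood outside the next one.
    So X is discrete. If x is eventually periodic with period p, the arrows
    u^i = (x, ip, x) form a copy of the group of integers, so the isotropy at
    x contributes Laurent polynomials in u; apply the chain lemma to
    h_n = 1 - u^(2^n). A relation h_n = g h_(n+1) says that the coefficients of
    g along the multiples of 2^(n+1) are constant except for a jump by 1 at 0,
    which contradicts finiteness of the support of g.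

    All of this requires that A be an associative ring, that is, that products
    of compact open bisections be compact open bisections and that convolution
    sums be finite. The former rests on a base of the topology of G made of sets
    Z(U, m, n, V) with U and V compact open, which is stable under intersection,
    inversion and product (basicI, basic_inv, basic_prod); it exists because a
    totally disconnected locally compact Hausdorff space has a base of compact
    open sets (totally_disconnected_base). *)

Local Open Scope classical_set_scope.

Set Implicit Arguments.
Unset Strict Implicit.
Unset Printing Implicit Defensive.

(** * Compact open sets in totally disconnected spaces *)

Section CompactOpen.
Variable T : topologicalType.
Implicit Types (A B C K U V W O : set T) (x y : T).

(** Compactness as an induction principle: a property of sets that is stable
    under finite unions and holds near each point of K holds on a set
    containing K. *)
Lemma compact_sub_union (P : set (set T)) K : compact K -> P set0 ->
    (forall A B, P A -> P B -> P (A `|` B)) ->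
    (forall x, K x -> exists2 A, P A & nbhs x A) ->
  exists2 A, P A & K `<=` A.
Proof.
move=> cK P0 PU PK; apply: contrapT => nP.
pose F := filter_from P (fun A => K `\` A).
have FF : ProperFilter F.
  apply: filter_from_proper.
    apply: filter_from_filter; first by exists set0.
    move=> A B PA PB; exists (A `|` B); first exact: PU.
    by move=> z [Kz nAB]; split; split=> // ?; apply: nAB; [left|right].
  move=> A PA; apply: contrapT => /nonemptyPn KA0; apply: nP; exists A => //.
  by move=> z Kz; apply: contrapT => nAz; rewrite -[False]/(set0 z) -KA0.
have [|x [Kx clFx]] := cK F FF; first by exists set0 => //; rewrite setD0.
have [A PA Ax] := PK x Kx.
have [|y [[_ nAy] Ay]] := clFx (K `\` A) A _ Ax; first by exists A.
exact: nAy.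
Qed.

Hypothesis hT : hausdorff_space T.

Lemma compact_separated A B : compact A -> compact B -> A `&` B = set0 ->
  exists U V, [/\ open U, open V, A `<=` U, B `<=` V & U `&` V = set0].
Proof.
pose sep C D := exists U V,
  [/\ open U, open V, C `<=` U, D `<=` V & U `&` V = set0].
have sep0 D : sep set0 D.
  by exists set0, setT; split=> //; [exact: open0|exact: openT|exact: set0I].
have sepU C C' D : sep C D -> sep C' D -> sep (C `|` C') D.
  move=> [U [V [oU oV CU DV UV]]] [U' [V' [oU' oV' CU' DV' UV']]].
  exists (U `|` U'), (V `&` V'); split; [exact: openU|exact: openI| | |].
  - by move=> z [/CU|/CU']; [left|right].
  - by move=> z Dz; split; [exact: DV|exact: DV'].
  - rewrite setIUl setIA UV set0I set0U [V `&` V']setIC setIA UV'.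
    exact: set0I.
have sepC C D : sep C D -> sep D C.
  by move=> [U [V [? ? ? ? UV]]]; exists V, U; split=> //; rewrite setIC.
have cover C D : compact C ->
    (forall x, C x -> exists2 C', sep C' D & nbhs x C') -> sep C D.
  move=> cC Csep.
  have [A' B'|C' [U [V [oU oV CU DV UV]]] CC'] :=
    @compact_sub_union (sep^~ D) C cC (sep0 D) _ Csep; first exact: sepU.
  by exists U, V; split=> //; exact: subset_trans CU.
have pointwise x y : x != y -> exists U V,
    [/\ open U, open V, U x, V y & U `&` V = set0].
  move: hT; rewrite open_hausdorff => /[apply] -[[U V]] /= [].
  by move=> [/set_mem Ux /set_mem Vy] [oU oV /eqP UV]; exists U, V.
move=> cA cB AB; rewrite -/(sep A B); apply: (cover _ _ _) => // x Ax.
suff [U [V [oU oV xU BV UV]]] : sep [set x] B.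
  exists U; first by exists U, V; split.
  by apply: open_nbhs_nbhs; split=> //; exact: xU.
apply: sepC; apply: cover => // y By.
have /pointwise[U [V [oU oV Ux Vy UV]]] : x != y.
  apply/eqP => xy; have : (A `&` B) x by split=> //; rewrite xy.
  by rewrite AB.
exists V; last exact: open_nbhs_nbhs.
by exists V, U; split=> //; [move=> _ ->|rewrite setIC].
Qed.

Let clopen_in C A := [/\ A `<=` C, closed A & closed (C `\` A)].

(** The intersection below is the quasicomponent of x in C. The part of C
    outside O is compact and each of its points is excluded by some relatively
    clopen set; finitely many of these suffice. *)
Lemma quasicomponent_sub C x O : compact C -> C x ->
    (\bigcap_(A in [set A | clopen_in C A /\ A x]) A) `<=` O -> open O ->
  exists2 A, clopen_in C A /\ A x & A `<=` O.
Proof.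
move=> cC Cx QO oO; have clC := compact_closed hT cC.
pose P D := exists2 A, clopen_in C A /\ A x & A `&` D = set0.
have cCO : compact (C `\` O).
  apply: subclosed_compact cC _; last by move=> ? [].
  by apply: closedI => //; exact: open_closedC.
have [|D D'|y [Cy nOy]|D [A [[AC clA clCA] Ax] AD0] CD] :=
    @compact_sub_union P _ cCO.
- exists C; last exact: setI0; split=> //; split=> //.
  by rewrite setDv; exact: closed0.
- move=> [A [[AC clA clCA] Ax] AD0] [A' [[AC' clA' clCA'] Ax'] AD0'].
  exists (A `&` A').
    split=> //; split; [by move=> ? [/AC]|exact: closedI|].
    by rewrite setDIr; exact: closedU.
  rewrite setIUr -setIA [A' `&` D]setIC setIA AD0 set0I set0U.
  by rewrite -setIA AD0' setI0.
- have : ~ (\bigcap_(A in [set A | clopen_in C A /\ A x]) A) y by move=> /QO.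
  move=> /existsNP[A] /not_implyP[[cA Ax] nAy].
  exists (~` A); first by exists A => //; exact: setICr.
  apply: open_nbhs_nbhs; split=> //; apply: closed_openC; by case: cA.
- exists A => // y Ay; apply: contrapT => nOy.
  rewrite -[False]/(set0 y) -AD0; split=> //.
  by apply: CD; split=> //; exact: AC.
Qed.

(** In a compact neighbourhood C of x the quasicomponent Q of x is connected,
    hence is the singleton x. So some relatively clopen set A of C containing x
    lies inside O and the interior of C, which makes it open in the space. *)
Lemma totally_disconnected_base x O :
    locally_compact [set: T] -> totally_disconnected [set: T] ->
    open O -> O x ->
  exists V, [/\ compact V, open V, V x & V `<=` O].
Proof.
move=> lcT tdT oO Ox; have [C nC [cC clC]] := lcT x I.
have {}nC : nbhs x C.
  by move: nC; rewrite /within /=; apply: filterS => y; exact.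
have Cx := nbhs_singleton nC.
pose Q := \bigcap_(A in [set A | clopen_in C A /\ A x]) A.
have Qx : Q x by move=> A [].
have clQ : closed Q by apply: closed_bigI => A [[]].
have QC : Q `<=` C.
  apply: bigcap_inf; split=> //; split=> //.
  by rewrite setDv; exact: closed0.
have Q_compact B : closed B -> B `<=` Q -> compact B.
  by move=> clB BQ; apply: subclosed_compact cC _ => //; exact: subset_trans QC.
(* A splitting of Q extends to disjoint open sets U and V; a clopen set A
   inside their union is split by them too, and its U part is again clopen. *)
have split_Q B B' : closed B -> closed B' -> B `|` B' = Q -> B `&` B' = set0 ->
    B x -> B' = set0.
  move=> clB clB' BB'Q BB'0 Bx.
  have cB : compact B by apply: Q_compact; rewrite // -BB'Q => ?; left.
  have cB' : compact B' by apply: Q_compact; rewrite // -BB'Q => ?; right.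
  have [U [V [oU oV BU BV UV]]] := compact_separated cB cB' BB'0.
  have [||A [[AC clA clCA] Ax] AUV] := @quasicomponent_sub C x (U `|` V) cC Cx.
  - by rewrite -/Q -BB'Q => z [/BU|/BV]; [left|right].
  - exact: openU.
  have AU : A `\` V = A `&` U.
    apply/seteqP; split=> z [Az Uz]; split=> //.
      by case: (AUV z Az).
    by move=> Vz; rewrite -[False]/(set0 z) -UV.
  have : Q `<=` A `\` V.
    apply: bigcap_inf; split; last by rewrite AU; split=> //; exact: BU.
    split; first by move=> ? [/AC].
      by apply: closedI => //; exact: open_closedC.
    have -> : C `\` (A `\` V) = (C `\` A) `|` (C `\` U).
      by rewrite AU setDIr.
    by apply: closedU => //; apply: closedI => //; exact: open_closedC.
  move=> QAV; rewrite -subset0 => z B'z.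
  have /QAV[_] : Q z by rewrite -BB'Q; right.
  by apply; exact: BV.
have cQ : connected Q.
  move=> B B0 [O' oO' BO'] [D clD BD].
  have clB : closed B by rewrite BD; exact: closedI.
  have clQB : closed (Q `\` B).
    have -> : Q `\` B = Q `\` O' by rewrite BO' setDIr setDv set0U.
    by apply: closedI => //; exact: open_closedC.
  have BQ : B `<=` Q by rewrite BO' => ? [].
  have BQB : B `|` Q `\` B = Q by rewrite setDUK.
  have BQ0 : B `&` (Q `\` B) = set0 by rewrite setIC setDKI.
  have [Bx|nBx] := pselect (B x).
    by rewrite -BQB (split_Q _ _ clB clQB BQB BQ0 Bx) setU0.
  have B_0 : B = set0.
    apply: (split_Q (Q `\` B)) => //; first by rewrite setUC.
    by rewrite setIC.
  by case: B0 => z; rewrite B_0.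
have {cQ} Q1 : Q `<=` [set x].
  by rewrite -(tdT x I); exact: connected_component_max.
have [||A [[AC clA clCA] Ax] AO] := @quasicomponent_sub C x (C° `&` O) cC Cx.
- by move=> z /Q1 ->; split.
- by apply: openI => //; exact: open_interior.
exists A; split=> //; last by move=> ? /AO[].
- by apply: subclosed_compact cC _.
- have -> : A = C° `\` (C `\` A).
    apply/seteqP; split=> z; first by move=> Az; split; [case: (AO z Az)|case].
    move=> [/interior_subset Cz nCA]; apply: contrapT => nAz; exact: nCA.
  by apply: openI; [exact: open_interior|exact: closed_openC].
Qed.

Definition compact_open A := compact A /\ open A.

Lemma compact_open0 : compact_open set0.
Proof. by split; [exact: compact0|exact: open0]. Qed.

Lemma compact_openU A B :
  compact_open A -> compact_open B -> compact_open (A `|` B).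
Proof. by move=> [? ?] [? ?]; split; [exact: compactU|exact: openU]. Qed.

Lemma compact_openI A B :
  compact_open A -> compact_open B -> compact_open (A `&` B).
Proof.
move=> [cA oA] [cB oB]; split; last exact: openI.
by apply: compact_closedI => //; exact: compact_closed.
Qed.

End CompactOpen.

(** * Iterates of the local homeomorphism *)

Lemma open_local (T : topologicalType) (A : set T) :
  (forall x, A x -> exists B, [/\ open B, B x & B `<=` A]) -> open A.
Proof.
move=> H; rewrite openE => x /H[B [oB Bx BA]].
by rewrite /interior; apply: filterS BA _; exact: open_nbhs_nbhs.
Qed.

Section Iterates.
Variables (X : topologicalType) (S : DRsystem X).
Implicit Types (U V W O : set X) (x y : X).
Local Notation D := (iter_dom S).
Local Notation s n := (iter n (dr_map S)).

Definition inj_on (f : X -> X) U :=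
  forall x y, U x -> U y -> f x = f y -> x = y.

Lemma dr_map_preimage_open O : open O -> open (dr_dom S `&` dr_map S @^-1` O).
Proof.
move=> oO; apply: open_local => x [Dx Ox].
have [U [oU Ux UD _ [g [_ cU _]]]] := dr_local_homeo Dx.
exists (U `&` dr_map S @^-1` O); split=> //; last by move=> y [/UD].
by move: cU; rewrite continuous_open_subspace// continuous_inP//; apply.
Qed.

Lemma dr_map_image_open O : open O -> O `<=` dr_dom S -> open (dr_map S @` O).
Proof.
move=> oO OD; apply: open_local => _ [x Ox <-].
have [U [oU Ux UD oimU [g [gK _ cg]]]] := dr_local_homeo (OD _ Ox).
exists (dr_map S @` U `&` g @^-1` (U `&` O)); split.
- move: cg; rewrite continuous_open_subspace// continuous_inP//; apply.
  exact: openI.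
- by split; [exists x|rewrite /preimage /= gK ?inE].
- by move=> _ [[y Uy <-]]; rewrite /preimage /= gK ?inE// => -[_ Oy]; exists y.
Qed.

Lemma iter_domD m n x : D (m + n) x <-> D m x /\ D n (s m x).
Proof.
elim: n => [|n IHn]; first by rewrite addn0; split=> // -[].
by rewrite addnS /= IHn -iterD addnC; split=> [[[]]|[? []]].
Qed.

Lemma iter_preimage_open m O : open O -> open (D m `&` s m @^-1` O).
Proof.
elim: m O => [|m IHm] O oO; first by rewrite setTI.
have -> : D m.+1 `&` s m.+1 @^-1` O =
    D m `&` s m @^-1` (dr_dom S `&` dr_map S @^-1` O).
  by apply/seteqP; split=> x; [move=> [[? ?] ?]|move=> [? [? ?]]].
exact/IHm/dr_map_preimage_open.
Qed.

Lemma iter_image_open m O : open O -> O `<=` D m -> open (s m @` O).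
Proof.
elim: m O => [|m IHm] O oO OD; first by rewrite image_id.
have -> : s m.+1 @` O = dr_map S @` (s m @` O).
  by rewrite -image_comp.
by apply: dr_map_image_open => [|_ [x /OD[_ ?] <-]//]; apply: IHm => // x /OD[].
Qed.

Lemma iter_locally_inj m x : D m x ->
  exists U, [/\ open U, U x, U `<=` D m & inj_on (s m) U].
Proof.
elim: m => [_|m IHm [Dx Dsx]]; first by exists setT; split=> //; exact: openT.
have [U [oU Ux UD injU]] := IHm Dx.
have [V [oV Vx VD _ [g [gK _ _]]]] := dr_local_homeo Dsx.
exists (U `&` (D m `&` s m @^-1` V)); split=> //.
- by apply: openI => //; exact: iter_preimage_open.
- by move=> y [_ [? /VD]].
move=> y z [Uy [_ Vy]] [Uz [_ Vz]] /= eyz; apply: injU => //.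
by rewrite -(gK (s m y)) ?inE// eyz gK// inE.
Qed.

(** The inverse is continuous because the iterates are open maps. *)
Lemma inj_homeo_onto_image m U :
  open U -> U `<=` D m -> inj_on (s m) U -> homeo_onto_image U (s m).
Proof.
move=> oU UD injU.
pose g y := if pselect (exists x, U x /\ s m x = y) is left e
            then projT1 (cid e) else y.
have gK x : U x -> g (s m x) = x.
  rewrite /g => Ux; case: pselect => [e|[]]; last by exists x.
  by case: cid => /= z [Uz]; exact: injU.
exists g; split; first by move=> x /set_mem /gK.
- rewrite continuous_open_subspace// continuous_inP// => O oO.
  have -> : U `&` s m @^-1` O = U `&` (D m `&` s m @^-1` O).
    by rewrite setIA (setIidl UD).
  by apply: openI => //; exact: iter_preimage_open.
- have oimU := iter_image_open oU UD.
  rewrite continuous_open_subspace// continuous_inP// => O oO.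
  have -> : s m @` U `&` g @^-1` O = s m @` (U `&` O).
    apply/seteqP; split=> [_ [[x Ux <-]]|_ [x [Ux Ox] <-]].
      by rewrite /preimage /= gK// => Ox; exists x.
    by split; [exists x|rewrite /preimage /= gK].
  by apply: iter_image_open => [|x [/UD]//]; exact: openI.
Qed.

Lemma compact_open_iter_image m W :
  compact_open W -> W `<=` D m -> compact_open (s m @` W).
Proof.
move=> [cW oW] WD; split; last exact: iter_image_open.
apply: continuous_compact => //.
rewrite continuous_open_subspace// continuous_inP// => O oO.
have -> : W `&` s m @^-1` O = W `&` (D m `&` s m @^-1` O).
  by rewrite setIA (setIidl WD).
by apply: openI => //; exact: iter_preimage_open.
Qed.

(** Compactness uses that W, being compact, is closed: the complement of the
    preimage in U is then open. *)
Lemma compact_open_iter_preimage m U W : compact_open U -> U `<=` D m ->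
  compact_open W -> compact_open (U `&` s m @^-1` W).
Proof.
move=> [cU oU] UD [cW oW].
have oI O : open O -> open (U `&` s m @^-1` O).
  move=> oO; have -> : U `&` s m @^-1` O = U `&` (D m `&` s m @^-1` O).
    by rewrite setIA (setIidl UD).
  by apply: openI => //; exact: iter_preimage_open.
have clW := compact_closed (dr_hausdorff S) cW.
have clU := compact_closed (dr_hausdorff S) cU.
split; last exact: oI.
apply: subclosed_compact cU _; last by move=> ? [].
have -> : U `&` s m @^-1` W = U `\` (U `&` s m @^-1` (~` W)).
  apply/seteqP; split=> x [Ux Wx]; split=> //; first by move=> [].
  by apply: contrapT => nWx; apply: Wx.
by apply: closedI => //; apply/open_closedC/oI; exact: closed_openC.
Qed.

Definition slice U m := [/\ compact_open U, U `<=` D m & inj_on (s m) U].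

Lemma sliceS U V m : slice U m -> compact_open V -> V `<=` U -> slice V m.
Proof.
move=> [_ UD injU] cV VU; split=> //; first exact: subset_trans UD.
by move=> x y /VU Ux /VU; exact: injU.
Qed.

Lemma sliceI U V m : slice U m -> compact_open V -> slice (U `&` V) m.
Proof.
move=> sU cV; apply: (sliceS sU); last by move=> ? [].
by apply: compact_openI => //; [exact: dr_hausdorff S|case: sU].
Qed.

Lemma slice_exists x m O : totally_disconnected [set: X] -> open O -> O x ->
  D m x -> exists U, [/\ slice U m, U x & U `<=` O].
Proof.
move=> hX oO Ox Dx; have [V [oV Vx VD injV]] := iter_locally_inj Dx.
have VOx : (V `&` O) x by [].
have [U [cU oU Ux UVO]] := totally_disconnected_base (dr_hausdorff S)
  (dr_locally_compact S) hX (openI oV oO) VOx.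
exists U; split=> //; last by move=> y /UVO[].
split=> //; first by move=> y /UVO[/VD].
by move=> y z /UVO[Vy _] /UVO[Vz _]; exact: injV.
Qed.

End Iterates.

(** * The groupoid and its compact open bisections *)

Section Groupoid.
Variables (X : topologicalType) (S : DRsystem X).
Implicit Types (U V W O : set X) (x y : X) (a b c : dr_arrow S).
Local Notation G := (dr_arrow S).
Local Notation D := (iter_dom S).
Local Notation s n := (iter n (dr_map S)).
Local Notation src := (@dr_source X S).
Local Notation rng := (@dr_range X S).
Local Notation deg := (@dr_degree X S).

Lemma arrow_eq a b : rng a = rng b -> deg a = deg b -> src a = src b -> a = b.
Proof.
move=> r d t; apply: val_inj; move: r d t.
rewrite /dr_range /dr_degree /dr_source.
by case: (val a) => -[? ?] ?; case: (val b) => -[? ?] ? /= -> -> ->.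
Qed.

Definition mk_arrow (g : X * int * X) (h : dr_rel S g) : G :=
  exist _ g (asboolT h).

Lemma arrowP a : exists m n : nat, [/\ deg a = (m%:Z - n%:Z)%R, D m (rng a),
  D n (src a) & s m (rng a) = s n (src a)].
Proof. exact: asboolW (valP a). Qed.

Lemma dr_rel_id x : dr_rel S (x, 0%R, x).
Proof. by exists 0%N, 0%N. Qed.

Lemma dr_rel_sym x k y : dr_rel S (x, k, y) -> dr_rel S (y, (- k)%R, x).
Proof. by move=> [m [n [/= -> Dx Dy e]]]; exists n, m; split=> //=; lia. Qed.

(** The exponents n and m' at the middle point y must be made equal by raising
    the smaller one, since y need not lie in the domain of the iterate of order
    n + m'; the reduction to n <= m' is by inversion. *)
Lemma dr_rel_trans x k y l z :
  dr_rel S (x, k, y) -> dr_rel S (y, l, z) -> dr_rel S (x, (k + l)%R, z).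
Proof.
wlog lenm : x k y l z / exists m n m' n' : nat,
    [/\ [/\ k = (m%:Z - n%:Z)%R, D m x, D n y & s m x = s n y],
        [/\ l = (m'%:Z - n'%:Z)%R, D m' y, D n' z & s m' y = s n' z] &
        (n <= m')%N].
  move=> H [m [n /= [ek Dx Dy e]]] [m' [n' /= [el Dy' Dz e']]].
  have [le|/ltnW le] := leqP n m'; first by apply: (H x k y l z);
    [exists m, n, m', n'|exists m, n|exists m', n'].
  suff /dr_rel_sym : dr_rel S (z, (- l + - k)%R, x).
    by rewrite opprD !opprK addrC.
  apply: (H z (- l)%R y (- k)%R x).
  - exists n', m', n, m; split=> //; split=> //; lia.
  - by exists n', m'; split=> //=; lia.
  - by exists n, m; split=> //=; lia.
move: lenm => [m [n [m' [n' [[ek Dx Dy e] [el Dy' Dz e'] le]]]]] _ _.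
move: le Dy' e' el => /subnKC <-; set j := (m' - n)%N => /iter_domD[_ Dj] e' el.
exists (j + m)%N, n'; split=> //=; first by lia.
  by rewrite addnC; apply/iter_domD; rewrite e.
by rewrite iterD e -iterD addnC.
Qed.

Definition arrow_inv a : G :=
  @mk_arrow (src a, (- deg a)%R, rng a) (dr_rel_sym (arrowP a)).

Lemma degree_inv a : deg (arrow_inv a) = (- deg a)%R. Proof. by []. Qed.

Lemma degree_mk_arrow g (h : dr_rel S g) : deg (mk_arrow h) = g.1.2.
Proof. by []. Qed.

Definition arrow_unit x : G := mk_arrow (dr_rel_id x).

(** Total version of the product; the value a is a placeholder when the arrows
    are not composable. *)
Definition arrow_mul a b : G :=
  if pselect (dr_rel S (rng a, (deg a + deg b)%R, src b)) is left h
  then mk_arrow h else a.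

Lemma arrow_mulP a b : src a = rng b ->
  [/\ rng (arrow_mul a b) = rng a, deg (arrow_mul a b) = (deg a + deg b)%R &
      src (arrow_mul a b) = src b].
Proof.
move=> ab; rewrite /arrow_mul; case: pselect => [h //|[]].
apply: (dr_rel_trans (arrowP a)).
rewrite -[(_, src b)]/(src a, deg b, src b) ab.
exact: (arrowP b).
Qed.

Lemma dr_prodE a b c : dr_prod a b c <->
  [/\ src a = rng b, rng c = rng a, deg c = (deg a + deg b)%R & src c = src b].
Proof.
split=> [[ab e]|[ab r d t]]; first by rewrite /dr_range /dr_degree /dr_source e.
split=> //; move: r d t; rewrite /dr_range /dr_degree /dr_source.
by case: (val c) => -[? ?] ? /= -> -> ->.
Qed.

Definition basic_bisection (A : set G) := exists U m n V,
  [/\ slice S U m, slice S V n & A = @dr_Z X S U m n V].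

Lemma basic_open A : basic_bisection A -> open A.
Proof.
move=> [U [m [n [V [[[cU oU] UD iU] [[cV oV] VD iV] ->]]]]].
pose Z := @dr_Z X S U m n V.
have ZS : @dr_subbase X S Z.
  by exists U, V, m, n; split=> //; exact: inj_homeo_onto_image.
exists [set Z]; last by rewrite bigcup_set1.
by move=> _ ->; exists [fset Z]%fset; [by move=> ? /fset1P ->; exact: mem_set|
  rewrite set_fset1 bigcap_set1].
Qed.

(** If the exponents differ then (m', n') = (m + j, n + j), say, and the
    equation at level (m, n) implies the one at level (m', n'). So the
    intersection is cut out at the smaller level. *)
Lemma basicI A B a : basic_bisection A -> basic_bisection B -> A a -> B a ->
  basic_bisection (A `&` B).
Proof.
move=> [U [m [n [V [sU sV ->]]]]] [U' [m' [n' [V' [sU' sV' ->]]]]].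
wlog le : U U' V V' m m' n n' sU sU' sV sV' / (m <= m')%N.
  move=> H; have [le|/ltnW le] := leqP m m'; first exact: H.
  by rewrite setIC => ? ?; exact: H.
move=> [_ _ da _] [_ _ da' _].
have le' : (n <= n')%N by lia.
have dd : (n' - n)%N = (m' - m)%N by lia.
exists (U `&` U'), m, n, (V `&` V'); split.
- by apply: sliceI => //; case: sU'.
- by apply: sliceI => //; case: sV'.
apply/seteqP; split=> b; first by move=> [[? ? ? ?] [? ? ? ?]].
move=> [[Ub U'b] [Vb V'b] db e]; split; split=> //; first lia.
by rewrite -(subnKC le) -(subnKC le') dd ![(_ + (m' - m))%N]addnC !iterD e.
Qed.

Lemma slice_inj U m x y : slice S U m -> U x -> U y -> s m x = s m y -> x = y.
Proof. by move=> [_ _]; exact. Qed.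

Lemma basic_inj A a b : basic_bisection A -> A a -> A b ->
  (rng a = rng b -> a = b) /\ (src a = src b -> a = b).
Proof.
move=> [U [m [n [V [sU sV ->]]]]] [Ua Va da ea] [Ub Vb db eb]; split=> e.
  apply: arrow_eq => //; rewrite ?da ?db//.
  by apply: (slice_inj sV) => //; rewrite -ea -eb e.
apply: arrow_eq => //; rewrite ?da ?db//.
by apply: (slice_inj sU) => //; rewrite ea eb e.
Qed.

Lemma dr_Z_range U m n V : V `<=` D n -> U `<=` D m ->
  rng @` @dr_Z X S U m n V = U `&` s m @^-1` (s n @` V).
Proof.
move=> VD UD; apply/seteqP; split=> [_ [a [Ua Va da e] <-]|x [Ux [y Vy e]]].
  by split=> //=; exists (src a).
have h : dr_rel S (x, (m%:Z - n%:Z)%R, y).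
  by exists m, n; split=> //=; [exact: UD|exact: VD].
by exists (mk_arrow h).
Qed.

Lemma basic_range A : basic_bisection A -> compact_open (rng @` A).
Proof.
move=> [U [m [n [V [[cU UD _] [cV VD _] ->]]]]]; rewrite dr_Z_range//.
by apply: compact_open_iter_preimage => //; exact: compact_open_iter_image.
Qed.

Lemma basic_inv A : basic_bisection A -> basic_bisection (arrow_inv @^-1` A).
Proof.
move=> [U [m [n [V [sU sV ->]]]]]; exists V, n, m, U; split=> //.
apply/seteqP; split=> a [/= ? ? da e]; split=> //=; move: da;
  rewrite degree_inv; lia.
Qed.

Definition setprod (A B : set G) : set G :=
  [set c | exists a b, [/\ A a, B b & dr_prod a b c]].

(** For factors Z(U, m, n, V) and Z(U', m', n', V') with n <= m', the product is
    again of this form, with exponents (m + m' - n, n'): on the points of U that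
    are matched with some y in both V and U', the iterate of order m + m' - n is
    injective because that of order m' is injective on U'. The case m' <= n
    follows by inversion. *)
Lemma basic_prod A B :
  basic_bisection A -> basic_bisection B -> basic_bisection (setprod A B).
Proof.
suff H U m n V U' m' n' V' : (n <= m')%N ->
    slice S U m -> slice S V n -> slice S U' m' -> slice S V' n' ->
    basic_bisection (setprod (@dr_Z X S U m n V) (@dr_Z X S U' m' n' V')).
  move=> [U [m [n [V [sU sV eA]]]]] [U' [m' [n' [V' [sU' sV' eB]]]]].
  have [le|/ltnW le] := leqP n m'; first by rewrite eA eB; exact: H.
  have /basic_inv := H _ _ _ _ _ _ _ _ le sV' sU' sV sU.
  congr basic_bisection; rewrite eA eB.
  apply/seteqP; split=> c.
    move=> [a [b [[? ? da ea] [? ? db eb]]]] /dr_prodE[/= ab r d t].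
    exists (arrow_inv b), (arrow_inv a); split.
    - by split=> //; rewrite degree_inv db; lia.
    - by split=> //; rewrite degree_inv da; lia.
    - by apply/dr_prodE; split=> //; move: d; rewrite !degree_inv; lia.
  move=> [a [b [[? ? da ea] [? ? db eb]]]] /dr_prodE[/= ab r d t].
  exists (arrow_inv b), (arrow_inv a); split.
  - by split=> //; rewrite degree_inv db; lia.
  - by split=> //; rewrite degree_inv da; lia.
  - by apply/dr_prodE; split=> //; rewrite !degree_inv; lia.
move=> le sU sV sU' sV'.
have [cU UD iU] := sU; have [cV VD iV] := sV.
have [cU' UD' iU'] := sU'.
pose W := V `&` U'; pose U2 := U `&` s m @^-1` (s n @` W).
have cW : compact_open W by apply: compact_openI => //; exact: dr_hausdorff S.
have WD : W `<=` D n by move=> y [/VD].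
pose j := (m' - n)%N; have ej : (n + j)%N = m' by exact: subnKC.
have sj y : s m' y = s j (s n y) by rewrite -iterD addnC ej.
have sj' x : s (m + j) x = s j (s m x) by rewrite -iterD addnC.
exists U2, (m + j)%N, n', V'; split=> //.
  split.
  - by apply: compact_open_iter_preimage => //; exact: compact_open_iter_image.
  - move=> x [Ux [y [Vy U'y] e]]; apply/iter_domD; split; first exact: UD.
    by rewrite -e; move: (UD' _ U'y); rewrite -ej => /iter_domD[].
  - move=> x x' [Ux [y [Vy U'y] e]] [Ux' [y' [Vy' U'y'] e']].
    rewrite !sj' -e -e' -!sj => /(iU' _ _ U'y U'y') yy'.
    by apply: iU => //; rewrite -e -e' yy'.
apply/seteqP; split=> c.
  move=> [a [b [[Ua Va da ea] [Ub Vb db eb]]]] /dr_prodE[ab r d t]; split.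
  - by rewrite r; split=> //=; exists (src a) => //; split=> //; rewrite ab.
  - by rewrite t.
  - by rewrite d da db; lia.
  - by rewrite sj' r ea -sj ab t.
move=> [[Uc [y [Vy U'y] e]] V'c dc]; rewrite sj' -e -sj => ec.
have ha : dr_rel S (rng c, (m%:Z - n%:Z)%R, y).
  by exists m, n; split=> //=; [exact: UD|exact: VD].
have hb : dr_rel S (y, (m'%:Z - n'%:Z)%R, src c).
  by exists m', n'; split=> //=; [exact: UD'|case: sV' => _ /(_ _ V'c)].
exists (mk_arrow ha), (mk_arrow hb); split=> //.
by apply/dr_prodE; split=> //; rewrite dc !degree_mk_arrow /=; lia.
Qed.

Hypothesis hX : totally_disconnected [set: X].

Lemma basic_base a (O : set G) : open O -> O a ->
  exists A, [/\ basic_bisection A, A a & A `<=` O].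
Proof.
have basic0 : exists2 A, basic_bisection A & A a.
  have [m [n [da Da Db e]]] := arrowP a.
  have [U [sU Ua _]] := slice_exists hX openT I Da.
  have [V [sV Va _]] := slice_exists hX openT I Db.
  by exists (@dr_Z X S U m n V) => //; exists U, m, n, V.
move=> [F FS eO] Oa.
have [B [FB Ba BO]] : exists B : set G, [/\ F B, B a & B `<=` O].
  move: Oa; rewrite -eO => -[B FB Ba]; exists B; split=> // b Bb.
  by exists B.
have [E ES eB] := FS _ FB.
have {}eB : \bigcap_(B' in [set` E]) B' = B by exact: eB.
have Ea : (\bigcap_(B' in [set` E]) B') a by rewrite eB.
suff [A [bA Aa AE]] : exists A, [/\ basic_bisection A, A a &
    forall B', B' \in (E : seq _) -> A `<=` B'].
  exists A; split=> // b Ab; apply: BO; rewrite -eB => B' EB'.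
  exact: (AE B' EB' b Ab).
have {}ES B' : B' \in (E : seq _) -> @dr_subbase X S B' /\ B' a.
  by move=> EB'; split; [exact: set_mem (ES _ EB')|exact: Ea].
elim: (E : seq _) ES => [_|B' E' IH ES].
  by have [A bA Aa] := basic0; exists A.
have [|A [bA Aa AE]] := IH.
  by move=> B2 B2E; apply: ES; rewrite inE B2E orbT.
have [[U [V [m [n [[oU oV] [UD VD] hU hV eB']]]]] B'a] := ES B' (mem_head _ _).
have [Ua Va da e] : @dr_Z X S U m n V a by rewrite -eB'.
have [U' [sU' Ua' UU']] := slice_exists hX oU Ua (UD _ Ua).
have [V' [sV' Va' VV']] := slice_exists hX oV Va (VD _ Va).
pose A' := @dr_Z X S U' m n V'.
have bA' : basic_bisection A' by exists U', m, n, V'.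
have Aa' : A' a by [].
exists (A `&` A'); split=> //; first exact: (basicI bA bA' Aa Aa').
move=> B2; rewrite inE => /orP[/eqP ->|/AE AB2]; last by move=> b [/AB2].
by rewrite eB' => b [_ [? ? ? ?]]; split=> //; [exact: UU'|exact: VV'].
Qed.

(** The inverse t of the range map on A is continuous, because the ranges of
    the basic subsets of A are open. So A is the continuous image of its range,
    which is compact. *)
Lemma basic_compact A : basic_bisection A -> compact A.
Proof.
move=> bA; have [->|/set0P[a0 Aa0]] := eqVneq A set0; first exact: compact0.
have [cA oA] := basic_range bA.
pose t x := if pselect (exists a, A a /\ rng a = x) is left h
            then projT1 (cid h) else a0.
have tA a : A a -> t (rng a) = a.
  move=> Aa; rewrite /t; case: pselect => [h|[]]; last by exists a.
  by case: cid => b /= [Ab /((basic_inj bA Ab Aa).1)].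
have -> : A = t @` (rng @` A).
  apply/seteqP; split=> [a Aa|_ [_ [a Aa <-] <-]]; last by rewrite tA.
  by exists (rng a); [exists a|exact: tA].
apply: continuous_compact => //.
rewrite continuous_open_subspace// continuous_inP// => O oO.
apply: open_local => _ [[a Aa <-]]; rewrite /preimage /= tA// => Oa.
have [B [bB Ba BO]] := basic_base oO Oa.
have bAB := basicI bA bB Aa Ba.
exists (rng @` (A `&` B)); split; [by have [] := basic_range bAB|by exists a|].
by move=> _ [b [Ab Bb] <-]; split; [exists b|rewrite /= tA//; exact: BO].
Qed.

Lemma basic_compact_open_bisection A :
  basic_bisection A -> @compact_open_bisection (dr_groupoid S) A.
Proof.
move=> bA; split; [exact: basic_compact|exact: basic_open| |];
  move=> a b /set_mem Aa /set_mem Ab e;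
  by have [+ +] := basic_inj bA Aa Ab; auto.
Qed.

Lemma setprodUl A A' B : setprod (A `|` A') B = setprod A B `|` setprod A' B.
Proof.
apply/seteqP; split=> c; first by move=> [a [b [[Aa|Aa] Bb abc]]];
  [left|right]; exists a, b.
by move=> [] [a [b [Aa Bb abc]]]; exists a, b; split=> //; [left|right].
Qed.

Lemma setprodUr A B B' : setprod A (B `|` B') = setprod A B `|` setprod A B'.
Proof.
apply/seteqP; split=> c; first by move=> [a [b [Aa [Bb|Bb] abc]]];
  [left|right]; exists a, b.
by move=> [] [a [b [Aa Bb abc]]]; exists a, b; split=> //; [left|right].
Qed.

(** Cover A and B by finitely many basic sets, whose products are basic. *)
Lemma setprod_compact A B :
  compact A -> open A -> compact B -> open B -> compact (setprod A B).
Proof.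
have sp0 C : setprod set0 C = set0.
  by rewrite -subset0 => c [a [b []]].
have sp0' C : setprod C set0 = set0.
  by rewrite -subset0 => c [a [b []]].
move=> cA oA cB oB.
pose P A' := A' `<=` A /\ compact (setprod A' B).
have [| |a Aa|A' [A'A cA'] AA'] := @compact_sub_union _ P A cA.
- by split; [exact: sub0set|rewrite sp0; exact: compact0].
- move=> A1 A2 [A1A c1] [A2A c2]; split; first by rewrite subUset.
  by rewrite setprodUl; exact: compactU.
- have [A' [bA' A'a A'A]] := basic_base oA Aa.
  exists A'; last by apply: open_nbhs_nbhs; split=> //; exact: basic_open.
  split=> //; pose Q B' := B' `<=` B /\ compact (setprod A' B').
  have [| |b Bb|B' [B'B cB'] BB'] := @compact_sub_union _ Q B cB.
  + by split; [exact: sub0set|rewrite sp0'; exact: compact0].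
  + move=> B1 B2 [B1B c1] [B2B c2]; split; first by rewrite subUset.
    by rewrite setprodUr; exact: compactU.
  + have [B' [bB' B'b B'B]] := basic_base oB Bb.
    exists B'; last by apply: open_nbhs_nbhs; split=> //; exact: basic_open.
    by split=> //; apply/basic_compact/basic_prod.
  + by have -> : B = B' by apply/seteqP.
- by have -> : A = A' by apply/seteqP.
Qed.

Lemma setprod_open A B : open A -> open B -> open (setprod A B).
Proof.
move=> oA oB; apply: open_local => c [a [b [Aa Bb abc]]].
have [A' [bA A'a A'A]] := basic_base oA Aa.
have [B' [bB B'b B'B]] := basic_base oB Bb.
exists (setprod A' B'); split.
- exact/basic_open/basic_prod.
- by exists a, b.
- by move=> c' [a' [b' [/A'A ? /B'B ? ?]]]; exists a', b'.
Qed.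

Lemma setprod_bisection A B :
  @compact_open_bisection (dr_groupoid S) A ->
  @compact_open_bisection (dr_groupoid S) B ->
  @compact_open_bisection (dr_groupoid S) (setprod A B).
Proof.
move=> [cA oA rA sA] [cB oB rB sB]; split.
- exact: setprod_compact.
- exact: setprod_open.
- move=> c c' /set_mem[a [b [Aa Bb]]] /dr_prodE[ab r d t].
  move=> /set_mem[a' [b' [Aa' Bb']]] /dr_prodE[ab' r' d' t'] /= e.
  have rr' : rng a = rng a' by exact: etrans (esym r) (etrans e r').
  have aa' : a = a' by exact: (rA _ _ (mem_set Aa) (mem_set Aa') rr').
  have rrb : rng b = rng b' by rewrite -ab -ab' aa'.
  have bb' : b = b' by exact: (rB _ _ (mem_set Bb) (mem_set Bb') rrb).
  by apply: arrow_eq => //; [rewrite d d' aa' bb'|rewrite t t' bb'].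
- move=> c c' /set_mem[a [b [Aa Bb]]] /dr_prodE[ab r d t].
  move=> /set_mem[a' [b' [Aa' Bb']]] /dr_prodE[ab' r' d' t'] /= e.
  have ss' : src b = src b' by exact: etrans (esym t) (etrans e t').
  have bb' : b = b' by exact: (sB _ _ (mem_set Bb) (mem_set Bb') ss').
  have ssa : src a = src a' by rewrite ab ab' bb'.
  have aa' : a = a' by exact: (sA _ _ (mem_set Aa) (mem_set Aa') ssa).
  by apply: arrow_eq => //; [rewrite r r' aa'|rewrite d d' aa' bb'].
Qed.

End Groupoid.

(** * Chain conditions in rings with local units *)

Section Rings.
Local Open Scope ring_scope.

Record rng_axioms (R : rngData) : Prop := {
  rng_subgroup : is_subgroup (relem R);
  rng_mul : forall a b, relem R a -> relem R b -> relem R (rmul a b);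
  rng_mulA : forall a b c, relem R a -> relem R b -> relem R c ->
    rmul a (rmul b c) = rmul (rmul a b) c;
  rng_mulBl : forall a b c, relem R a -> relem R b -> relem R c ->
    rmul (a - b) c = rmul a c - rmul b c;
  rng_mulBr : forall a b c, relem R a -> relem R b -> relem R c ->
    rmul a (b - c) = rmul a b - rmul a c
}.

Definition has_local_units (R : rngData) :=
  forall B : set (rambient R), finite_set B -> B `<=` relem R ->
  exists e, [/\ relem R e, rmul e e = e &
    forall b, B b -> rmul e b = b /\ rmul b e = b].

Lemma subgroup0 (M : zmodType) (N : set M) : is_subgroup N -> N 0.
Proof. by case. Qed.

Lemma subgroupB (M : zmodType) (N : set M) x y :
  is_subgroup N -> N x -> N y -> N (x - y).
Proof. by case=> _; apply. Qed.

Lemma subgroupN (M : zmodType) (N : set M) x : is_subgroup N -> N x -> N (- x).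
Proof.
by move=> sN Nx; rewrite -sub0r; apply: subgroupB => //; exact: subgroup0 sN.
Qed.

Lemma subgroupD (M : zmodType) (N : set M) x y :
  is_subgroup N -> N x -> N y -> N (x + y).
Proof.
move=> sN Nx Ny; rewrite -[y]opprK.
by apply: subgroupB => //; exact: subgroupN.
Qed.

Section Rng.
Variable R : rngData.
Hypothesis hR : rng_axioms R.
Implicit Types a b e f g : rambient R.
Local Notation "a *r b" := (rmul a b) (at level 40, left associativity).

Let R0 : relem R 0 := subgroup0 (rng_subgroup hR).

Lemma rng_mul0 a : relem R a -> (0 *r a = 0) /\ (a *r 0 = 0).
Proof.
move=> Ra; split.
  by rewrite -[X in X *r _](subrr a) (rng_mulBl hR) ?subrr.
by rewrite -[X in _ *r X](subrr a) (rng_mulBr hR) ?subrr.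
Qed.

Lemma rng_mulDl a b c : relem R a -> relem R b -> relem R c ->
  (a + b) *r c = a *r c + b *r c.
Proof.
move=> Ra Rb Rc; have RNb := subgroupN (rng_subgroup hR) Rb.
have bc : (- b) *r c = - (b *r c).
  by rewrite -[in LHS](sub0r b) (rng_mulBl hR)// (rng_mul0 Rc).1 sub0r.
transitivity ((a - - b) *r c); first by rewrite opprK.
by rewrite (rng_mulBl hR)// bc opprK.
Qed.

Lemma rng_mulDr a b c : relem R a -> relem R b -> relem R c ->
  a *r (b + c) = a *r b + a *r c.
Proof.
move=> Ra Rb Rc; have RNc := subgroupN (rng_subgroup hR) Rc.
have ac : a *r (- c) = - (a *r c).
  by rewrite -[in LHS](sub0r c) (rng_mulBr hR)// (rng_mul0 Ra).2 sub0r.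
transitivity (a *r (b - - c)); first by rewrite opprK.
by rewrite (rng_mulBr hR)// ac opprK.
Qed.

Lemma cornerP e f : relem R e -> e *r e = e ->
  relem (corner e) f <-> [/\ relem R f, e *r f = f & f *r e = f].
Proof.
move=> Re ee; split=> [[a Ra <-]|[Rf ef fe]]; last first.
  by exists f; rewrite // ef fe.
have Rea := rng_mul hR Re Ra; split; first exact: rng_mul.
  by rewrite (rng_mulA hR)// (rng_mulA hR)// ee.
by rewrite -(rng_mulA hR)// ee.
Qed.

(** If b lies in the corner of e then so does every h n, and the left multiples
    of h n in that corner form a descending chain of left ideals. *)
Lemma locally_artinian_chain b (h : nat -> rambient R) :
    locally_artinian R -> relem R b -> (forall n, relem R (h n)) ->
    (forall n, b *r h n = h n /\ h n *r b = h n) ->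
    (forall n, exists2 k, relem R k & h n.+1 = k *r h n) ->
  exists n g, relem R g /\ h n = g *r h n.+1.
Proof.
move=> laR Rb Rh bh hS.
have [|e [Re ee Be aR]] := laR [set b] (finite_set1 b); first by move=> _ ->.
have [_ eb be] : [/\ relem R b, e *r b = b & b *r e = b].
  by apply/cornerP => //; exact: Be.
have eh n : relem (corner e) (h n).
  have [bhn hbn] := bh n; apply/cornerP => //; split=> //.
    by rewrite -bhn (rng_mulA hR)// eb.
  by rewrite -hbn -(rng_mulA hR)// be.
have Rcorner f : relem (corner e) f -> relem R f.
  by move=> /(cornerP _ Re ee)[].
pose I n := [set f | relem (corner e) f /\
  exists g, relem R g /\ f = g *r h n].
have [n|n f [cf [g [Rg eg]]]|n0 In0] := aR I.
- split; first by move=> f [].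
    split.
      split; last by exists 0; rewrite (rng_mul0 (Rh n)).1.
      by apply/cornerP => //; rewrite (rng_mul0 Re).1 (rng_mul0 Re).2.
    move=> f f' [/(cornerP _ Re ee)[Rf ef fe] [g [Rg eg]]].
    move=> [/(cornerP _ Re ee)[Rf' ef' fe'] [g' [Rg' eg']]]; split.
      apply/cornerP => //; split; first exact: (subgroupB (rng_subgroup hR)).
        by rewrite (rng_mulBr hR)// ef ef'.
      by rewrite (rng_mulBl hR)// fe fe'.
    exists (g - g'); split; first exact: (subgroupB (rng_subgroup hR)).
    by rewrite (rng_mulBl hR)// eg eg'.
  move=> a f /(cornerP _ Re ee)[Ra ea ae].
  move=> [/(cornerP _ Re ee)[Rf ef fe] [g [Rg eg]]]; split.
    apply/cornerP => //; split; first exact: (rng_mul hR).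
      by rewrite (rng_mulA hR)// ea.
    by rewrite -(rng_mulA hR)// fe.
  exists (a *r g); split; first exact: (rng_mul hR).
  by rewrite eg (rng_mulA hR).
- have [k Rk hk] := hS n; split; first exact: cf.
  exists (g *r k); split; first exact: (rng_mul hR).
  by rewrite eg hk (rng_mulA hR).
have : I n0.+1 (h n0).
  rewrite In0//; split; first exact: eh.
  by exists b; split=> //; have [] := bh n0.
by move=> [_ [g [Rg eg]]]; exists n0, g.
Qed.

End Rng.

Section SubgroupType.
Variables (M : zmodType) (N : set M).

(** The proof that N is a subgroup is an argument of the predicate, so that the
    algebraic structure of the subtype can be inferred. *)
Definition subgroup_pred of is_subgroup N : {pred M} := fun x => `[< N x >].

Variable sN : is_subgroup N.

Let subgroup_pred_closed : zmod_closed (subgroup_pred sN).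
Proof.
split; first by apply/asboolP; exact: subgroup0.
by move=> x y /asboolP Nx /asboolP Ny; apply/asboolP; exact: subgroupB.
Qed.

HB.instance Definition _ :=
  GRing.isZmodClosed.Build M (subgroup_pred sN) subgroup_pred_closed.

Definition subgroup_type := {x : M | x \in subgroup_pred sN}.

HB.instance Definition _ := SubChoice.on subgroup_type.
HB.instance Definition _ := [SubChoice_isSubZmodule of subgroup_type by <:].

Lemma subgroup_typeP (x : subgroup_type) : N (val x).
Proof. exact: asboolW (valP x). Qed.

Definition subgroup_elem x (Nx : N x) : subgroup_type := exist _ x (asboolT Nx).

End SubgroupType.

Section CategoricallyToLocally.
Variable R : rngData.
Hypothesis hR : rng_axioms R.
Local Notation "a *r b" := (rmul a b) (at level 40, left associativity).

Section Corner.
Variable e : rambient R.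
Hypotheses (Re : relem R e) (ee : e *r e = e).

(** The left ideal R e, as the set of elements fixed by e on the right. *)
Definition principal := [set f | relem R f /\ f *r e = f].

Let principal_subgroup : is_subgroup principal.
Proof.
have sR := rng_subgroup hR.
split; first by split; [exact: subgroup0|rewrite (rng_mul0 hR Re).1].
move=> f g [Rf fe] [Rg ge]; split; first exact: (subgroupB sR).
by rewrite (rng_mulBl hR)// fe ge.
Qed.

Let Me : zmodType := subgroup_type principal_subgroup.

Let principalM a (x : Me) : relem R a -> principal (a *r val x).
Proof.
move=> Ra; have [Rx xe] := subgroup_typeP x; split; first exact: (rng_mul hR).
by rewrite -(rng_mulA hR)// xe.
Qed.

Definition principal_act (a : rambient R) (x : Me) : Me :=
  if pselect (relem R a) is left Ra
  then subgroup_elem principal_subgroup (principalM x Ra) else 0.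

Let val_act a (x : Me) : relem R a -> val (principal_act a x) = a *r val x.
Proof. by move=> Ra; rewrite /principal_act; case: pselect. Qed.

Let principal_module : left_module principal_act.
Proof.
split=> [a b x Ra Rb|a x y Ra|a b x Ra Rb]; apply: val_inj.
- have [Rx _] := subgroup_typeP x.
  rewrite raddfD /= !val_act ?(rng_mulDl hR)//.
  exact: (subgroupD (rng_subgroup hR)).
- have [Rx _] := subgroup_typeP x; have [Ry _] := subgroup_typeP y.
  by rewrite raddfD /= !val_act// raddfD /= (rng_mulDr hR).
- have [Rx _] := subgroup_typeP x.
  by rewrite !val_act ?(rng_mulA hR)//; exact: (rng_mul hR).
Qed.

Let eM : Me := subgroup_elem principal_subgroup (conj Re ee : principal e).

Let actE (x : Me) : x = principal_act (val x) eM.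
Proof.
by apply: val_inj; have [Rx xe] := subgroup_typeP x; rewrite val_act.
Qed.

(** A left ideal I of e R e is sent to the submodule of those x in R e such
    that e R x is contained in I; intersecting it with e R e gives I back. *)
Lemma corner_left_artinian :
  categorically_artinian R -> left_artinian (corner e).
Proof.
move=> caR I lI decI.
have aM : artinian_module principal_act.
  apply: (caR _ _ principal_module).
    apply/seteqP; split=> // x _ N [sN]; apply.
    by exists (val x), eM; split=> //; have [] := subgroup_typeP x.
  exists [set eM]; split; first exact: finite_set1.
  apply/seteqP; split=> // x _ N [[sN actN] eN]; rewrite [x]actE.
  by apply: actN; [have [] := subgroup_typeP x|exact: eN].
have cornerI n f : I n f -> [/\ relem R f, e *r f = f & f *r e = f].
  by case: (lI n) => + _ _ => /[apply] /(cornerP hR _ Re ee).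
pose N n := [set x : Me | forall a, relem R a -> I n (e *r (a *r val x))].
have [n|n x Nx a /Nx|n0 Nn0] := aM N; last 1 first.
- have NI n f : I n f <-> exists2 x : Me, N n x & e *r val x = f /\ val x = f.
    split=> [If|[x Nx [ex xf]]].
      have [Rf ef fe] := cornerI _ _ If.
      have pf : principal f by [].
      exists (subgroup_elem principal_subgroup pf) => //= a Ra.
      have Rea := rng_mul hR Re Ra.
      have -> : e *r (a *r f) = ((e *r a) *r e) *r f.
        by rewrite -[RHS](rng_mulA hR)// ef -(rng_mulA hR).
      by case: (lI n) => _ _; apply=> //; exists a.
    by have := Nx e Re; rewrite ex -xf ex xf.
  exists n0 => n le; apply/seteqP; split=> f /NI[x Nx xf]; apply/NI;
    exists x => //; move: Nx; by rewrite Nn0.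
- have [_ [I0 IB] IM] := lI n; split.
    split=> [a Ra|x y Nx Ny a Ra].
      by rewrite raddf0 (rng_mul0 hR Ra).2 (rng_mul0 hR Re).2.
    have [Rx _] := subgroup_typeP x; have [Ry _] := subgroup_typeP y.
    rewrite raddfB (rng_mulBr hR)// (rng_mulBr hR)//; try exact: (rng_mul hR).
    by apply: IB; [exact: Nx|exact: Ny].
  move=> a x Ra Nx b Rb; have [Rx _] := subgroup_typeP x.
  rewrite val_act// [b *r _](rng_mulA hR)//; apply: Nx; exact: (rng_mul hR).
- by move=> Ix; apply: decI.
Qed.

End Corner.

Lemma categorically_locally_artinian :
  has_local_units R -> categorically_artinian R -> locally_artinian R.
Proof.
move=> luR caR B fB BR; have [e [Re ee Be]] := luR B fB BR.
exists e; split=> //; last exact: corner_left_artinian.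
move=> b Bb; apply/(cornerP hR) => //; have [eb be] := Be b Bb.
by split=> //; exact: BR.
Qed.

End CategoricallyToLocally.

Section SimpleVectors.
Variables (R : rngData) (M : zmodType) (act : rambient R -> M -> M).
Hypotheses (hR : rng_axioms R) (hM : left_module act).
Implicit Types (a b : rambient R) (x y v w : M).

(** The submodule R v is simple or zero. *)
Definition simple_vector v :=
  forall a, relem R a ->
    act a v = 0 \/ exists2 b, relem R b & act b (act a v) = v.

Fixpoint span (s : seq M) : set M :=
  if s is v :: s' then
    [set x | exists m a, [/\ span s' m, relem R a & x = m + act a v]]
  else [set 0].

Let sR := rng_subgroup hR.

Let actB a b x : relem R a -> relem R b -> act (a - b) x = act a x - act b x.
Proof.
move=> Ra Rb; apply: (addIr (act b x)); rewrite subrK -(act_addl hM)// ?subrK//.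
exact: (subgroupB sR).
Qed.

Let actBr a x y : relem R a -> act a (x - y) = act a x - act a y.
Proof.
by move=> Ra; apply: (addIr (act a y)); rewrite subrK -(act_addr hM)// subrK.
Qed.

Let act0 x : act 0 x = 0.
Proof.
have R0 := subgroup0 sR.
by apply: (addIr (act 0 x)); rewrite -(act_addl hM)// !add0r.
Qed.

Let actr0 a : relem R a -> act a 0 = 0.
Proof.
by move=> Ra; apply: (addIr (act a 0)); rewrite -(act_addr hM)// !add0r.
Qed.

Lemma span_submodule s : submodule act (span s).
Proof.
elim: s => [|v s [sS actS]] /=.
  split; first by split=> // x y -> ->; rewrite subr0.
  by move=> a x Ra ->; exact: actr0.
split; first split.
- exists 0, 0; split; [exact: subgroup0|exact: subgroup0|by rewrite act0 addr0].
- move=> _ _ [m [a [sm Ra ->]]] [m' [a' [sm' Ra' ->]]].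
  exists (m - m'), (a - a'); split; [exact: subgroupB|exact: subgroupB|].
  by rewrite actB// opprD addrACA.
- move=> b _ Rb [m [a [sm Ra ->]]]; exists (act b m), (rmul b a); split.
  + exact: actS.
  + exact: (rng_mul hR).
  + by rewrite (act_addr hM)// (act_mul hM).
Qed.

Lemma span_cat s t x y : span s x -> span t y -> span (s ++ t) (x + y).
Proof.
elim: s x => [x ->|v s IH x /= [m [a [sm Ra ->]]]] ty; first by rewrite add0r.
by exists (m + y), a; split=> //; [exact: IH|rewrite addrAC].
Qed.

(** Induction on s, with the same alternative as in the proof that an extension
    of Artinian modules is Artinian: either v lies in N n + span s for all n,
    and then elements of N n0 can be corrected by N n into span s; or from some
    n on it does not, and then, v being simple, the elements of N n in the span
    of v :: s lie in span s already. *)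
Lemma span_chain_stable s (N : nat -> set M) :
    (forall v, v \in s -> simple_vector v) ->
    (forall n, submodule act (N n)) -> (forall n, N n.+1 `<=` N n) ->
  exists n0, forall n, (n0 <= n)%N -> N n0 `&` span s `<=` N n.
Proof.
move=> + sN decN.
have antiN m n : (m <= n)%N -> N n `<=` N m.
  move=> /subnKC <-; elim: (n - m)%N => [|k IH]; first by rewrite addn0.
  by rewrite addnS; apply: subset_trans IH.
elim: s => [_|v s IHs simS].
  by exists 0%N => n _ x [_ ->]; apply: subgroup0; case: (sN n).
have [|n1 Hn1] := IHs; first by move=> w ws; apply: simS; rewrite inE ws orbT.
have [sS actS] := span_submodule s.
have simv : simple_vector v by apply: simS; rewrite mem_head.
have [T|/existsNP[n2 nT]] :=
  pselect (forall n, exists2 w, N n w & span s (v - w)).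
  exists n1 => n le y [Ny [m [a [sm Ra ey]]]].
  have [w Nw vw] := T n; have [subN actN] := sN n.
  have Naw : N n (act a w) by exact: actN.
  rewrite -(subrK (act a w) y); apply: subgroupD => //.
  apply: Hn1 (le) _ _; split.
    by apply: subgroupB => //; [case: (sN n1)|exact: antiN Naw].
  rewrite ey -addrA -actBr//; apply: subgroupD => //; exact: actS.
exists (maxn n1 n2) => n; rewrite geq_max => /andP[le1 le2] y.
move=> [Ny [m [a [sm Ra ey]]]].
have [av0|[b Rb bav]] := simv a Ra.
  apply: Hn1 le1 _ _; split; first exact: antiN (leq_maxl _ _) _ Ny.
  by rewrite ey av0 addr0.
case: nT; exists (act b y).
  by case: (sN n2) => _ + ; apply=> //; exact: antiN (leq_maxr _ _) _ Ny.
rewrite ey (act_addr hM)// bav opprD addrCA subrr addr0.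
by apply: subgroupN => //; exact: actS.
Qed.

Lemma simple_span_artinian :
    (forall x, exists2 s, forall v, v \in s -> simple_vector v & span s x) ->
  finitely_generated act -> artinian_module act.
Proof.
move=> simM [B [fB genB]].
have [s simS Bs] :
    exists2 s, forall v, v \in s -> simple_vector v & B `<=` span s.
  have /finite_seqP[t ->] := fB.
  elim: t => [|x t [s simS ts]]; first by exists [::] => // x; rewrite /= inE.
  have [s' simS' xs'] := simM x.
  exists (s' ++ s); first by move=> v; rewrite mem_cat => /orP[/simS'|/simS].
  move=> y /=; rewrite inE => /orP[/eqP ->|/ts ys].
    rewrite -[x]addr0; apply: span_cat => //.
    by apply: subgroup0; case: (span_submodule s).
  rewrite -[y]add0r; apply: span_cat => //.
  by apply: subgroup0; case: (span_submodule s').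
have {Bs} spanT x : span s x.
  have : smallest (submodule act) B x by rewrite genB.
  by apply; split=> //; exact: span_submodule.
move=> N sN decN; have [n0 Hn0] := span_chain_stable simS sN decN.
exists n0 => n le; apply/seteqP; split=> [|x Nx]; last exact: Hn0.
move: le => /subnKC <-; elim: (n - n0)%N => [|k IH]; first by rewrite addn0.
by rewrite addnS; apply: subset_trans IH.
Qed.

End SimpleVectors.
End Rings.

(** * Convolution and the ring structure of the Steinberg algebra *)

Section Convolution.
Local Open Scope ring_scope.
Variables (K : fieldType) (X : topologicalType) (S : DRsystem X).
Implicit Types (U V W : set X) (x y : X).
Local Notation G := (dr_arrow S).
Implicit Types (a b c : G) (f g h : G -> K).
Local Notation src := (@dr_source X S).
Local Notation rng := (@dr_range X S).
Local Notation deg := (@dr_degree X S).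
Local Notation conv := (@convolution K (dr_groupoid S)).
Local Notation A := (relem (steinberg_algebra K (dr_groupoid S))).

Lemma arrow_mulK_prod a c :
  rng a = rng c -> dr_prod a (arrow_mul (arrow_inv a) c) c.
Proof.
move=> ac; have [r d t] := @arrow_mulP _ _ (arrow_inv a) c ac.
by apply/dr_prodE; split=> //; rewrite d degree_inv addNKr.
Qed.

Lemma arrow_mulVK_prod b c :
  src b = src c -> dr_prod (arrow_mul c (arrow_inv b)) b c.
Proof.
move=> bc; have [r d t] := @arrow_mulP _ _ c (arrow_inv b) (esym bc).
by apply/dr_prodE; split=> //; rewrite d degree_inv subrK.
Qed.

Lemma dr_prod_left a b c :
  dr_prod a b c -> rng a = rng c /\ b = arrow_mul (arrow_inv a) c.
Proof.
move=> /dr_prodE[ab r d t]; split=> //.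
have [r' d' t'] := @arrow_mulP _ _ (arrow_inv a) c (esym r).
by apply: arrow_eq; rewrite ?r' ?d' ?t' ?degree_inv ?d ?addKr//.
Qed.

Lemma dr_prod_right a b c :
  dr_prod a b c -> src b = src c /\ a = arrow_mul c (arrow_inv b).
Proof.
move=> /dr_prodE[ab r d t]; split=> //.
have [r' d' t'] := @arrow_mulP _ _ c (arrow_inv b) t.
by apply: arrow_eq; rewrite ?r' ?d' ?t' ?degree_inv ?d ?addrK//.
Qed.

Lemma arrow_mul_invA a c b : rng a = rng c -> src b = src c ->
  arrow_mul (arrow_mul (arrow_inv a) c) (arrow_inv b) =
  arrow_mul (arrow_inv a) (arrow_mul c (arrow_inv b)).
Proof.
move=> ac bc.
have [r1 d1 t1] := @arrow_mulP _ _ (arrow_inv a) c ac.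
have [r2 d2 t2] := @arrow_mulP _ _ c (arrow_inv b) (esym bc).
have [|r3 d3 t3] := @arrow_mulP _ _ (arrow_mul (arrow_inv a) c) (arrow_inv b).
  by rewrite t1.
have [|r4 d4 t4] := @arrow_mulP _ _ (arrow_inv a) (arrow_mul c (arrow_inv b)).
  by rewrite r2.
by apply: arrow_eq; rewrite ?r3 ?r4 ?d3 ?d4 ?t3 ?t4 ?r1 ?d1 ?d2 ?t2 ?addrA.
Qed.

Definition rsupp f x := [set a | rng a = x /\ f a <> 0].
Definition ssupp f x := [set a | src a = x /\ f a <> 0].

(** A factorisation of c is determined by its left factor a, which can be any
    arrow with the same range as c. *)
Lemma conv_rsupp f g c : conv f g c =
  \sum_(a \in rsupp f (rng c)) f a * g (arrow_mul (arrow_inv a) c).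
Proof.
rewrite /convolution.
rewrite (reindex_fsbig (fun a => (a, arrow_mul (arrow_inv a) c))
  [set a | rng a = rng c]).
  by apply/esym/fsbig_widen => [a []//|a [/= ac nfa]]; rewrite /preimage /=;
    have [->|/eqP fa] := eqVneq (f a) 0; [rewrite mul0r|case: nfa].
split.
- by move=> a ac; exact: arrow_mulK_prod.
- by move=> a a' _ _ [].
- by move=> [a b] /= /dr_prod_left[ac ->]; exists a.
Qed.

Lemma conv_ssupp f g c : conv f g c =
  \sum_(b \in ssupp g (src c)) f (arrow_mul c (arrow_inv b)) * g b.
Proof.
rewrite /convolution.
rewrite (reindex_fsbig (fun b => (arrow_mul c (arrow_inv b), b))
  [set b | src b = src c]).
  by apply/esym/fsbig_widen => [a []//|b [/= bc ngb]]; rewrite /preimage /=;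
    have [->|/eqP gb] := eqVneq (g b) 0; [rewrite mulr0|case: ngb].
split.
- by move=> a ac; exact: arrow_mulVK_prod.
- by move=> a a' _ _ [].
- by move=> [a b] /= /dr_prod_right[bc ->]; exists b.
Qed.

Definition row_finite f := forall x, finite_set (rsupp f x).
Definition col_finite f := forall x, finite_set (ssupp f x).

(** Both sides are the sum of f(a) g(d) h(b) over the factorisations c = adb
    with a and b in the finite supports of f and h over the range and the
    source of c. *)
Lemma convA f g h : row_finite f -> col_finite h ->
  conv f (conv g h) = conv (conv f g) h.
Proof.
move=> ff fh; apply/funext => c; rewrite conv_rsupp [RHS]conv_ssupp.
transitivity (\sum_(a \in rsupp f (rng c)) \sum_(b \in ssupp h (src c))
    f a * (g (arrow_mul (arrow_inv a) (arrow_mul c (arrow_inv b))) * h b)).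
  apply: eq_fsbigr => a /set_mem[ac _].
  have [_ _ t] := @arrow_mulP _ _ (arrow_inv a) c ac.
  rewrite conv_ssupp t mulr_fsumr; apply: eq_fsbigr => b /set_mem[bc _].
  by rewrite arrow_mul_invA.
rewrite exchange_fsbig//; apply: eq_fsbigr => b /set_mem[bc _].
have [r _ _] := @arrow_mulP _ _ c (arrow_inv b) (esym bc).
by rewrite conv_rsupp r mulr_fsuml; apply: eq_fsbigr => a _; rewrite mulrA.
Qed.

Lemma conv_linearl k f g h : col_finite h ->
  conv (fun c => k * f c + g c) h = fun c => k * conv f h c + conv g h c.
Proof.
move=> fh; apply/funext => c; rewrite !conv_ssupp mulr_fsumr -fsbig_split//.
by apply: eq_fsbigr => b _; rewrite mulrDl mulrA.
Qed.

Lemma conv_linearr k f g h : row_finite h ->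
  conv h (fun c => k * f c + g c) = fun c => k * conv h f c + conv h g c.
Proof.
move=> fh; apply/funext => c; rewrite !conv_rsupp mulr_fsumr -fsbig_split//.
by apply: eq_fsbigr => b _; rewrite mulrDr mulrCA.
Qed.

Lemma indicE_in (T : Type) (U : set T) t : U t -> (\1_U t : K) = 1.
Proof. by move=> Ut; rewrite indicE mem_set. Qed.

Lemma indicE_out (T : Type) (U : set T) t : ~ U t -> (\1_U t : K) = 0.
Proof. by move=> Ut; rewrite indicE memNset. Qed.

Definition rng_inj (U : set G) :=
  forall a b, U a -> U b -> rng a = rng b -> a = b.

Definition src_inj (U : set G) :=
  forall a b, U a -> U b -> src a = src b -> a = b.

Lemma conv_indicl (U : set G) g a c : rng_inj U -> U a -> rng a = rng c ->
  conv \1_U g c = g (arrow_mul (arrow_inv a) c).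
Proof.
move=> injU Ua ac; rewrite conv_rsupp.
have -> : rsupp \1_U (rng c) = [set a].
  apply/seteqP; split=> [b [bc Ub]|_ ->]; last first.
    by split=> //; rewrite indicE_in//; apply/eqP; exact: oner_neq0.
  apply: injU => //; last by rewrite bc.
  by apply: contrapT => nUb; apply: Ub; exact: indicE_out.
by rewrite fsbig_set1 indicE_in// mul1r.
Qed.

Lemma conv_indicl0 (U : set G) g c : (forall a, U a -> rng a <> rng c) ->
  conv \1_U g c = 0.
Proof.
move=> nU; rewrite conv_rsupp fsbig1// => a [ac _].
by rewrite indicE_out ?mul0r// => /nU.
Qed.

Lemma conv_indicr (V : set G) f b c : src_inj V -> V b -> src b = src c ->
  conv f \1_V c = f (arrow_mul c (arrow_inv b)).
Proof.
move=> injV Vb bc; rewrite conv_ssupp.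
have -> : ssupp \1_V (src c) = [set b].
  apply/seteqP; split=> [a [ac Va]|_ ->]; last first.
    by split=> //; rewrite indicE_in//; apply/eqP; exact: oner_neq0.
  apply: injV => //; last by rewrite bc.
  by apply: contrapT => nVa; apply: Va; exact: indicE_out.
by rewrite fsbig_set1 indicE_in// mulr1.
Qed.

Lemma conv_indicr0 (V : set G) f c : (forall b, V b -> src b <> src c) ->
  conv f \1_V c = 0.
Proof.
move=> nV; rewrite conv_ssupp fsbig1// => b [bc _].
by rewrite [\1_V b]indicE_out ?mulr0// => /nV.
Qed.

Lemma conv_indic (U V : set G) : rng_inj U ->
  conv \1_U \1_V = \1_(setprod U V).
Proof.
move=> injU; apply/funext => c.
have [[a [b [Ua Vb abc]]]|nUV] := pselect (setprod U V c).
  have [ac eb] := dr_prod_left abc.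
  rewrite (conv_indicl _ injU Ua ac) -eb !indicE_in//.
  by exists a, b.
rewrite [RHS]indicE_out// conv_rsupp fsbig1// => a [ac _].
have [Ua|nUa] := pselect (U a); last by rewrite indicE_out ?mul0r.
rewrite [X in _ * X]indicE_out ?mulr0// => Vb.
apply: nUV; exists a, (arrow_mul (arrow_inv a) c); split=> //.
exact: arrow_mulK_prod.
Qed.

Lemma bisection_inj (U : set G) : @compact_open_bisection (dr_groupoid S) U ->
  rng_inj U /\ src_inj U.
Proof.
move=> [_ _ rU sU]; split=> a b Ua Ub; [apply: rU|apply: sU];
  by rewrite inE.
Qed.

Lemma steinberg_subspace : @is_subspace K G A.
Proof.
split=> [W [sW _]|k f g Af Ag W WB]; first by case: sW.
by case: (WB) => [[_ +] _]; apply; [exact: Af|exact: Ag].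
Qed.

Lemma steinberg_indic (U : set G) :
  @compact_open_bisection (dr_groupoid S) U -> A \1_U.
Proof. by move=> bU W [_]; apply; exists U. Qed.

Lemma steinberg_ind (W : set (G -> K)) : @is_subspace K G W ->
    (forall U : set G, @compact_open_bisection (dr_groupoid S) U -> W \1_U) ->
  A `<=` W.
Proof. by move=> sW WU f; apply; split=> // _ [U bU <-]; exact: WU. Qed.

Lemma finite_subsingleton (T : Type) (B : set T) :
  (forall t u, B t -> B u -> t = u) -> finite_set B.
Proof.
move=> B1; have [->|/set0P[a Ba]] := eqVneq B set0; first exact: finite_set0.
by apply: (sub_finite_set _ (finite_set1 a)) => b Bb; exact: B1.
Qed.

Lemma steinberg_row_col_finite f : A f -> row_finite f /\ col_finite f.
Proof.
have nz k (u v : K) : k * u + v <> 0 -> u <> 0 \/ v <> 0.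
  have [->|/eqP] := eqVneq u 0; last by left.
  by rewrite mulr0 add0r; right.
apply: (@steinberg_ind [set f | row_finite f /\ col_finite f]); last first.
  move=> U /bisection_inj[rU sU].
  have in1 a : \1_U a <> 0 :> K -> U a.
    by move=> nz1; apply: contrapT => nUa; apply: nz1; exact: indicE_out.
  split=> x; apply: finite_subsingleton => a b [<- /in1 Ua] [+ /in1 Ub].
    by move=> /esym; exact: rU.
  by move=> /esym; exact: sU.
split.
  by split=> x; apply: (sub_finite_set _ (finite_set0 _)) => a [_].
move=> k g h [rg cg] [rh ch]; split=> x.
- apply: (@sub_finite_set _ _ (rsupp g x `|` rsupp h x)).
    by move=> a [ax /nz[]]; [left|right].
  by rewrite finite_setU.
- apply: (@sub_finite_set _ _ (ssupp g x `|` ssupp h x)).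
    by move=> a [ax /nz[]]; [left|right].
  by rewrite finite_setU.
Qed.

Let Arow f : A f -> row_finite f.
Proof. by move=> /steinberg_row_col_finite[]. Qed.

Let Acol f : A f -> col_finite f.
Proof. by move=> /steinberg_row_col_finite[]. Qed.

Lemma conv0l g : conv (fun=> 0) g = fun=> 0.
Proof.
by apply/funext => c; rewrite conv_rsupp fsbig1// => a _; rewrite mul0r.
Qed.

Lemma conv0r g : conv g (fun=> 0) = fun=> 0.
Proof.
by apply/funext => c; rewrite conv_rsupp fsbig1// => a _; rewrite mulr0.
Qed.

Hypothesis hX : totally_disconnected [set: X].

Lemma steinberg_mul f g : A f -> A g -> A (conv f g).
Proof.
have [A0 AD] := steinberg_subspace.
move=> Af Ag; move: f Af; apply: (@steinberg_ind [set f | A (conv f g)]).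
  split; first by rewrite /= conv0l.
  by move=> k f f' fg fg'; rewrite /= conv_linearl; [exact: AD|exact: Acol].
move=> U bU; move: g Ag; apply: (@steinberg_ind [set g | A (conv \1_U g)]).
  split; first by rewrite /= conv0r.
  move=> k f f' fg fg'; rewrite /= conv_linearr; first exact: AD.
  by apply: Arow; exact: steinberg_indic.
move=> V bV; rewrite /= conv_indic; last by case: (bisection_inj bU).
by apply: steinberg_indic; exact: setprod_bisection.
Qed.

Lemma fun_sub_linear f g : f - g = (fun c => (-1) * g c + f c).
Proof. by apply/funext => c; rewrite mulN1r addrC. Qed.

Lemma steinberg_rng : rng_axioms (steinberg_algebra K (dr_groupoid S)).
Proof.
have [A0 AD] := steinberg_subspace; split.
- by split=> // f g Af Ag; rewrite fun_sub_linear; exact: AD.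
- exact: steinberg_mul.
- by move=> f g h Af Ag Ah; apply: convA; [exact: Arow|exact: Acol].
- move=> f g h Af Ag Ah; rewrite /= !fun_sub_linear.
  by rewrite conv_linearl//; exact: Acol.
- move=> f g h Af Ag Ah; rewrite /= !fun_sub_linear.
  by rewrite conv_linearr//; exact: Arow.
Qed.

Definition unit_set V := @dr_Z X S V 0 0 V.

Lemma unit_basic V : compact_open V -> basic_bisection (unit_set V).
Proof.
by move=> cV; exists V, 0%N, 0%N, V; split=> //; split=> // ? ? _ _.
Qed.

Lemma unit_setP V a : unit_set V a <-> exists2 x, V x & a = arrow_unit S x.
Proof.
split=> [[Va _ da e]|[x Vx ->]]; last by split.
by exists (rng a) => //; apply: arrow_eq.
Qed.

Lemma arrow_mul_unitl c : arrow_mul (arrow_inv (arrow_unit S (rng c))) c = c.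
Proof.
have [r d t] := @arrow_mulP _ _ (arrow_inv (arrow_unit S (rng c))) c erefl.
apply: arrow_eq; rewrite ?r ?d ?t// degree_inv /=.
by rewrite [deg (arrow_unit _ _)]/(0%R) oppr0 add0r.
Qed.

Lemma arrow_mul_unitr c : arrow_mul c (arrow_inv (arrow_unit S (src c))) = c.
Proof.
have [r d t] := @arrow_mulP _ _ c (arrow_inv (arrow_unit S (src c))) erefl.
apply: arrow_eq; rewrite ?r ?d ?t// degree_inv /=.
by rewrite [deg (arrow_unit _ _)]/(0%R) oppr0 addr0.
Qed.

Lemma unit_inj V : rng_inj (unit_set V) /\ src_inj (unit_set V).
Proof.
by split=> a b /unit_setP[x Vx ->] /unit_setP[y Vy ->];
  rewrite /dr_range /dr_source /= => ->.
Qed.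

Lemma conv_unitl V f c : V (rng c) -> conv \1_(unit_set V) f c = f c.
Proof.
move=> Vc; rewrite (@conv_indicl _ _ (arrow_unit S (rng c))) ?arrow_mul_unitl//.
  by case: (unit_inj V).
Qed.

Lemma conv_unitl0 V f c : ~ V (rng c) -> conv \1_(unit_set V) f c = 0.
Proof.
by move=> nVc; apply: conv_indicl0 => a [Va _ _ _] ac; apply: nVc; rewrite -ac.
Qed.

Lemma conv_unitr V f c : V (src c) -> conv f \1_(unit_set V) c = f c.
Proof.
move=> Vc; rewrite (@conv_indicr _ _ (arrow_unit S (src c))) ?arrow_mul_unitr//.
  by case: (unit_inj V).
Qed.

Lemma conv_unitr0 V f c : ~ V (src c) -> conv f \1_(unit_set V) c = 0.
Proof.
by move=> nVc; apply: conv_indicr0 => a [_ Va _ _] ac; apply: nVc; rewrite -ac.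
Qed.

Definition supported_on V f := forall c, f c <> 0 -> V (rng c) /\ V (src c).

Lemma conv_unit_id V f : supported_on V f ->
  conv \1_(unit_set V) f = f /\ conv f \1_(unit_set V) = f.
Proof.
move=> Vf; have f0 c : ~ V (rng c) \/ ~ V (src c) -> f c = 0.
  by move=> nV; apply: contrapT => /Vf[? ?]; case: nV.
split; apply/funext => c.
  have [Vc|nVc] := pselect (V (rng c)); first exact: conv_unitl.
  by rewrite conv_unitl0// f0//; left.
have [Vc|nVc] := pselect (V (src c)); first exact: conv_unitr.
by rewrite conv_unitr0// f0//; right.
Qed.

Lemma steinberg_unit V : compact_open V -> A \1_(unit_set V).
Proof.
move=> cV; apply: steinberg_indic.
by apply: basic_compact_open_bisection; [exact: hX|exact: unit_basic].
Qed.

Lemma unit_supported V W : V `<=` W -> supported_on W \1_(unit_set V).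
Proof.
move=> VW c nz; have [Vr Vs _ _] : unit_set V c.
  by apply: contrapT => nV; apply: nz; exact: indicE_out.
by split; exact: VW.
Qed.

Lemma supported_onS V W f : V `<=` W -> supported_on V f -> supported_on W f.
Proof. by move=> VW Vf c /Vf[/VW ? /VW]. Qed.

(** A compact subset of G is covered by finitely many basic sets Z(U, m, n, V),
    whose ranges and sources lie in the compact open sets U and V. *)
Lemma steinberg_supported f :
  A f -> exists2 V, compact_open V & supported_on V f.
Proof.
apply: (@steinberg_ind [set f | exists2 V, compact_open V & supported_on V f]).
  split; first by exists set0; [exact: compact_open0|].
  move=> k g h [V cV Vg] [W cW Wh].
  exists (V `|` W); first exact: compact_openU.
  move=> c nz; have [gc|/eqP gc] := eqVneq (g c) 0.
    have [|? ?] := Wh c; last by split; right.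
    by move: nz; rewrite gc mulr0 add0r.
  by have [? ?] := Vg c gc; split; left.
move=> U [cU oU _ _].
pose P (B : set G) :=
  exists2 V, compact_open V & forall a, B a -> V (rng a) /\ V (src a).
have [||a Ua|B [V cV VB] UB] := @compact_sub_union _ P U cU.
- by exists set0; [exact: compact_open0|].
- move=> B C [V cV VB] [W cW WC]; exists (V `|` W); first exact: compact_openU.
  by move=> a [/VB[]|/WC[]]; split; [left|left|right|right].
- have [B [bB Ba _]] := basic_base hX oU Ua.
  exists B; last by apply: open_nbhs_nbhs; split=> //; exact: basic_open.
  have [U' [m [n [V' [[cU' _ _] [cV' _ _] eB]]]]] := bB.
  exists (U' `|` V'); first exact: compact_openU.
  by rewrite eB => b [? ? _ _]; split; [left|right].
- exists V => // c nz; apply/VB/UB.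
  by apply: contrapT => nU; apply: nz; exact: indicE_out.
Qed.

Lemma steinberg_local_units :
  has_local_units (steinberg_algebra K (dr_groupoid S)).
Proof.
move=> B fB BA.
have [V cV VB] : exists2 V, compact_open V & forall f, B f -> supported_on V f.
  move: fB BA => /finite_seqP[s ->]; elim: s => [_|f s IH sA].
    by exists set0; [exact: compact_open0|].
  have [|V cV Vs] := IH.
    by move=> g gs; apply: sA; rewrite /= inE gs orbT.
  have [|W cW Wf] := @steinberg_supported f.
    by apply: sA; exact: mem_head.
  exists (V `|` W); first exact: compact_openU.
  move=> g; rewrite /= inE => /orP[/eqP ->|/Vs Vg].
    by apply: supported_onS Wf; right.
  by apply: supported_onS Vg; left.
exists \1_(unit_set V); split; first exact: steinberg_unit.
  by have [] := conv_unit_id (@unit_supported V V (@subset_refl _ V)).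
by move=> f /VB/conv_unit_id.
Qed.

End Convolution.

(** * The equivalence *)

Section Main.
Local Open Scope ring_scope.
Variables (K : fieldType) (X : topologicalType) (S : DRsystem X).
Hypothesis hX : totally_disconnected [set: X].
Implicit Types (U V W : set X) (x y : X).
Local Notation G := (dr_arrow S).
Implicit Types (a b c : G) (f g h : G -> K).
Local Notation src := (@dr_source X S).
Local Notation rng := (@dr_range X S).
Local Notation deg := (@dr_degree X S).
Local Notation conv := (@convolution K (dr_groupoid S)).
Local Notation R := (steinberg_algebra K (dr_groupoid S)).
Local Notation A := (relem R).
Local Notation D := (iter_dom S).
Local Notation s n := (iter n (dr_map S)).

Lemma shrinking_compact_opens x : ~ open [set x] ->
  exists V : nat -> set X, forall n, [/\ compact_open (V n), V n x,
    V n.+1 `<=` V n & exists2 y, V n y & ~ V n.+1 y].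
Proof.
move=> nox.
have step V : exists V', compact_open V -> V x -> [/\ compact_open V', V' x,
    V' `<=` V & exists2 y, V y & ~ V' y].
  have [[[cV oV] Vx]|nV] := pselect (compact_open V /\ V x); last first.
    by exists V => cV Vx; case: nV.
  have [y Vy yx] : exists2 y, V y & y <> x.
    apply: contrapT => nV; apply: nox.
    suff -> : [set x] = V by [].
    apply/seteqP; split=> [_ -> //|y Vy].
    by apply: contrapT => yx; apply: nV; exists y.
  have oVy : open (V `\ y).
    apply: openI => //; apply: closed_openC; apply: accessible_closed_set1.
    exact/hausdorff_accessible/(dr_hausdorff S).
  have [|V' [cV' oV' V'x V'V]] := totally_disconnected_base (x := x)
      (dr_hausdorff S) (dr_locally_compact S) hX oVy.
    by split=> // xy; apply: yx.
  exists V' => _ _; split=> //; first by move=> z /V'V[].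
  by exists y => // /V'V[_]; apply.
have [F HF] := choice step.
have [V0 [cV0 oV0 V0x _]] := totally_disconnected_base
      (dr_hausdorff S) (dr_locally_compact S) hX openT (I : [set: X] x).
have HV n : compact_open (iter n F V0) /\ iter n F V0 x.
  elim: n => [|n [cVn Vnx]] //=.
  by have [] := HF _ cVn Vnx.
exists (fun n => iter n F V0) => n; have [cVn Vnx] := HV n.
by have [? ? ? ?] := HF _ cVn Vnx; split.
Qed.

(** The indicators e n of shrinking neighbourhoods V n of x form a divisibility
    chain, and e n = g * e n.+1 fails at a unit y of V n outside V n.+1, where
    the right-hand side vanishes. *)
Lemma locally_artinian_discrete : locally_artinian R -> discrete_space X.
Proof.
move=> laR; suff ox x : open [set x].
  by move=> B; apply: open_local => x Bx; exists [set x]; split=> // _ ->.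
apply: contrapT => /shrinking_compact_opens[V HV].
have cV n : compact_open (V n) by case: (HV n).
have VS n : V n.+1 `<=` V n by case: (HV n).
have V0 n : V n `<=` V 0%N.
  by elim: n => [|n IH] //; exact: subset_trans (VS n) IH.
pose e n : G -> K := \1_(@unit_set X S (V n)).
have [|n|n|n|n [g [Ag eg]]] :=
    @locally_artinian_chain R (steinberg_rng K S hX) (e 0%N) e laR.
- exact: steinberg_unit.
- exact: steinberg_unit.
- by apply: conv_unit_id; apply: unit_supported; exact: V0.
- exists (e n.+1); first exact: steinberg_unit.
  exact: (esym (conv_unit_id (@unit_supported K X S _ _ (VS n))).2).
have [_ _ _ [y Vy nVy]] := HV n.
have := congr1 (fun f => f (arrow_unit S y)) eg.
rewrite /= /e conv_unitr0// indicE_in; first by move=> /eqP; rewrite oner_eq0.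
by apply/unit_setP; exists y.
Qed.

Section Discrete.
Hypothesis dX : discrete_space X.

Lemma compact_open_point x : compact_open [set x].
Proof. by split; [exact: compact_set1|exact: dX]. Qed.

Lemma slice_point x m : D m x -> slice S [set x] m.
Proof.
by move=> Dx; split; [exact: compact_open_point|move=> _ ->|move=> ? ? -> ->].
Qed.

Lemma arrow_basic a : basic_bisection [set a].
Proof.
have [m [n [da Dr Ds e]]] := arrowP a.
exists [set rng a], m, n, [set src a].
split; [exact: slice_point|exact: slice_point|].
apply/seteqP; split=> [_ -> //|b [rb sb db _]]; apply: arrow_eq => //.
by rewrite db da.
Qed.

Lemma arrow_bisection a : @compact_open_bisection (dr_groupoid S) [set a].
Proof. by apply: (basic_compact_open_bisection hX); exact: arrow_basic. Qed.

Local Notation delta a := (\1_[set a] : G -> K).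

Lemma steinberg_delta a : A (delta a).
Proof. by apply: steinberg_indic; exact: arrow_bisection. Qed.

Lemma steinberg_sub f g : A f -> A g -> A (f - g).
Proof. exact: (subgroupB (rng_subgroup (steinberg_rng K S hX))). Qed.

Lemma steinberg_add f g : A f -> A g -> A (f + g).
Proof. exact: (subgroupD (rng_subgroup (steinberg_rng K S hX))). Qed.

Lemma conv_delta a b c : dr_prod a b c -> conv (delta a) (delta b) = delta c.
Proof.
move=> abc; rewrite conv_indic; last by move=> ? ? -> ->.
congr (\1_ _); apply/seteqP; split=> [d [_ [_ [-> -> abd]]]|_ ->]; last first.
  by exists a, b.
by apply: val_inj; case: abd => _ ->; case: abc => _ ->.
Qed.

Lemma periodic_rel m p x : D (m + p)%N x -> s (m + p) x = s m x ->
  forall i : int, dr_rel S (x, i * p%:Z, x).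
Proof.
move=> Dx e.
have pos k : dr_rel S (x, k%:Z * p%:Z, x).
  have [Dk ek] : D (m + k * p)%N x /\ s (m + k * p) x = s m x.
    elim: k => [|k [Dk ek]].
      by rewrite mul0n addn0; have /iter_domD[] := Dx.
    have -> : (m + k.+1 * p = m + k * p + p)%N by lia.
    have [_ Dp] := (iter_domD S m p x).1 Dx.
    split; first by apply/iter_domD; rewrite ek.
    by rewrite addnC iterD ek -iterD addnC.
  have Dm : D m x by have /iter_domD[] := Dx.
  by exists (m + k * p)%N, m; split=> //=; lia.
case=> k; first exact: pos.
have := dr_rel_sym (pos k.+1); congr (dr_rel S (x, _, x)); lia.
Qed.

(** The arrows w i are the integral powers of one arrow u, and h n = 1 - u^(2^n)
    divides h n.+1 with cofactor 1 + u^(2^n). The converse divisibility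
    h n = g * h n.+1 is a difference equation with step q n.+1 = 2^(n+1) for the
    coefficients of g (gw): its right-hand side is supported at 0 among the
    multiples of this step, so the coefficients at these multiples take one
    value from 0 upwards and another one, smaller by 1, below 0. Finite support
    forces both values to be 0. *)
Lemma locally_artinian_aperiodic :
  locally_artinian R -> ~ exists x, eventually_periodic S x.
Proof.
move=> laR [x [m [p [p1 Dx e]]]].
have per := periodic_rel Dx e.
pose w i := mk_arrow (per i).
have ww i j : dr_prod (w i) (w j) (w (i + j)).
  by apply/dr_prodE; split=> //; rewrite !degree_mk_arrow /= mulrDl.
have w_inj i j : w i = w j -> i = j.
  move=> /(congr1 (@dr_degree _ _)); rewrite !degree_mk_arrow /= => eij.
  have p0 : p%:Z != 0 by lia.
  exact: (mulIf p0).
pose q n : int := (2 ^ n)%:Z.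
have qS n : q n + q n = q n.+1 by rewrite /q expnS; lia.
have q_gt0 n : (0 < q n)%R by rewrite /q; have := expn_gt0 2 n; lia.
pose h n := delta (w 0) - delta (w (q n)).
have Ah n : A (h n) by apply: steinberg_sub; exact: steinberg_delta.
have delta_at a c : delta a c = (c == a)%:R.
  have [->|/eqP ca] := eqVneq c a; first by rewrite indicE_in.
  by rewrite indicE_out.
have [|n|n|n [g [Ag hg]]] :=
    @locally_artinian_chain R (steinberg_rng K S hX)
      \1_(@unit_set X S [set x]) h laR _ Ah.
- by apply: steinberg_unit => //; exact: compact_open_point.
- apply: conv_unit_id => c.
  have [->|c0] := eqVneq c (w 0); first by [].
  have [->|cq] := eqVneq c (w (q n)); first by [].
  by rewrite /h /= !fctE !delta_at (negbTE c0) (negbTE cq) subrr.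
- exists (delta (w 0) + delta (w (q n))).
    by apply: steinberg_add; exact: steinberg_delta.
  have rR := steinberg_rng K S hX.
  have Ad i := steinberg_delta (w i).
  rewrite (rng_mulBr rR) ?(rng_mulDl rR)//; last exact: steinberg_add.
  rewrite /= !(conv_delta (ww _ _)) !addr0 !add0r qS.
  by rewrite opprD addrA addrK.
have gw i : g (w i) - g (w (i - q n.+1)) = (i == 0)%:R - (i == q n)%:R.
  have hE k : h k = fun c => (-1) * delta (w (q k)) c + delta (w 0) c.
    exact: fun_sub_linear.
  have weq j k : (w j == w k) = (j == k) by apply/eqP/eqP => [/w_inj|->].
  have gd k : conv g (delta (w k)) (w i) = g (w (i - k)).
    rewrite (@conv_indicr _ _ _ _ _ (w k))//; last by move=> ? ? -> ->.
    by have := ww (i - k) k; rewrite subrK => /dr_prod_right[_ <-].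
  have hi : h n (w i) = conv g (h n.+1) (w i).
    exact: (congr1 (fun f => f (w i)) hg).
  have rg : row_finite g by case: (steinberg_row_col_finite Ag).
  move: hi; rewrite !hE conv_linearr// !gd !delta_at !weq subr0 !mulN1r.
  by rewrite [LHS]addrC [X in _ = X -> _]addrC => ->.
pose u i := g (w (i * q n.+1)).
have uS i : i != 0 -> u i = u (i - 1).
  move=> i0; apply/eqP; rewrite -subr_eq0 /u mulrBl mul1r gw.
  have -> : (i * q n.+1 == 0) = false.
    by apply/negbTE; rewrite mulf_neq0//; have := q_gt0 n.+1; lia.
  have -> : (i * q n.+1 == q n) = false.
    apply/negbTE/eqP; rewrite -qS => E.
    (* (2i - 1) 2^n is not 0, by parity *)
    have /eqP := E.
    rewrite -subr_eq0 (_ : _ - _ = (i + i - 1) * q n); last by lia.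
    by rewrite mulf_eq0 => /orP[/eqP|/eqP]; [lia|have := q_gt0 n; lia].
  by rewrite subrr.
have u0 : u 0 - u (- 1) = 1.
  have := gw 0; rewrite /u mul0r mulN1r sub0r eqxx => ->.
  by rewrite (_ : (0 == q n) = false) ?subr0//; have := q_gt0 n; lia.
have cg : col_finite g by case: (steinberg_row_col_finite Ag).
have vanish (t : nat -> int) (v : K) :
    injective t -> (forall k, u (t k) = v) -> v = 0.
  move=> t_inj ut; apply: contrapT => v0.
  apply: (@infinite_nat).
  have /(finite_preimage (f := fun k => w (t k * q n.+1))) := cg x.
  have -> : (fun k => w (t k * q n.+1)) @^-1` ssupp g x = [set: nat].
    apply/seteqP; split=> // k _; split=> //.
    by rewrite -[g _]/(u (t k)) ut.
  apply=> j k _ _ /w_inj eq; apply: t_inj; apply: mulIf eq.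
  by have := q_gt0 n.+1; lia.
have up : u 0 = 0.
  apply: (vanish (fun k => k%:Z)) => [j k [] //|k].
  elim: k => // k IH; rewrite uS; last by lia.
  by rewrite -IH; congr u; lia.
have um : u (- 1) = 0.
  apply: (vanish (fun k => - 1 - k%:Z)) => [j k ejk|k]; first by lia.
  elim: k => [|k IH]; first by rewrite subr0.
  by rewrite -IH [RHS]uS; [congr u; lia|lia].
by move/eqP: u0; rewrite up um subr0 eq_sym oner_eq0.
Qed.

Lemma steinberg_finite_support f : A f -> finite_set [set c | f c <> 0].
Proof.
apply: (@steinberg_ind _ _ _ [set f | finite_set [set c : G | f c <> 0]]).
  split; first by apply: (sub_finite_set _ (finite_set0 _)) => c.
  move=> k g h fg fh.
  apply: (@sub_finite_set _ _ ([set c | g c <> 0] `|` [set c | h c <> 0])).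
    move=> c /= nz; have [gc|/eqP gc] := eqVneq (g c) 0; last by left.
    by right => hc; apply: nz; rewrite gc hc mulr0 addr0.
  by rewrite finite_setU.
move=> U [cU oU _ _].
have [||a Ua|B fB UB] := @compact_sub_union _ (@finite_set G) U cU.
- exact: finite_set0.
- by move=> B C fB fC; rewrite finite_setU.
- exists [set a]; first exact: finite_set1.
  by apply: open_nbhs_nbhs; split=> //; exact/basic_open/arrow_basic.
- apply: sub_finite_set fB => c nz; apply: UB.
  by apply: contrapT => nU; apply: nz; exact: indicE_out.
Qed.

Lemma finite_support_ind (P : (G -> K) -> Prop) : P (fun=> 0) ->
    (forall k a f, P f -> P (fun c => k * delta a c + f c)) ->
  forall f, finite_set [set c | f c <> 0] -> P f.
Proof.
move=> P0 PD f /finite_seqP[t ft].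
have {ft} : forall c, c \notin t -> f c = 0.
  move=> c /negP ct; apply: contrapT => fc; apply: ct.
  by have : [set` t] c by rewrite -ft.
elim: t f => [|a t IH] f ft.
  by rewrite (_ : f = fun=> 0)//; apply/funext => c; exact: ft.
rewrite (_ : f = fun c => f a * delta a c + (if c == a then 0 else f c)).
  apply: PD; apply: IH => c ct; case: eqP => // /eqP ca.
  by apply: ft; rewrite inE negb_or ca.
apply/funext => c; have [->|/eqP ca] := eqVneq c a.
  by rewrite indicE_in// mulr1 addr0.
by rewrite indicE_out// mulr0 add0r.
Qed.

(** An arrow (x, m - n, x) with m <> n would make x eventually periodic. *)
Lemma aperiodic_isotropy c : ~ (exists x, eventually_periodic S x) ->
  rng c = src c -> c = arrow_unit S (rng c).
Proof.
move=> ap rs; have [m [n [dc Dr Ds e]]] := arrowP c.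
apply: arrow_eq => //; rewrite dc degree_mk_arrow /=.
have [mn|nm|->] := ltngtP m n; last by lia.
  case: ap; exists (rng c), m, (n - m)%N; rewrite subnKC ?(ltnW mn)//.
  by split; [lia|rewrite rs|rewrite e rs].
case: ap; exists (rng c), n, (m - n)%N; rewrite subnKC ?(ltnW nm)//.
by split; [lia| |rewrite e -rs].
Qed.

(** Let c, with source x, be in the support of f. Multiplying f * e by the point
    mass at the inverse of c moves the value f c to the unit at x. All arrows in
    the support of the product start and end at x, and since the isotropy is
    trivial that unit is the only such arrow. *)
Lemma unit_minimal x f : ~ (exists x, eventually_periodic S x) -> A f ->
  let e := delta (arrow_unit S x) in
  conv f e = 0 \/ exists2 g, A g & conv g (conv f e) = e.
Proof.
move=> ap Af e.
have eE : e = \1_(@unit_set X S [set x]).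
  congr (\1_ _); apply/seteqP; split=> c; last by move=> /unit_setP[_ -> ->].
  by move=> ->; apply/unit_setP; exists x.
have fe_in c : src c = x -> conv f e c = f c.
  by rewrite eE => cx; exact: conv_unitr.
have fe_out c : src c <> x -> conv f e c = 0.
  by rewrite eE => cx; exact: conv_unitr0.
have [fe0|/existsNP[c /eqP fec]] := pselect (forall c, conv f e c = 0).
  by left; apply/funext.
right; have cx : src c = x.
  by apply: contrapT => cx; move: fec; rewrite fe_out ?eqxx.
have {fec} fc : f c != 0 by rewrite -fe_in.
exists (fun d => (f c)^-1 * delta (arrow_inv c) d + 0).
  have [A0 AD] := steinberg_subspace K S.
  by apply: AD => //; exact: steinberg_delta.
have Ae : A e by exact: steinberg_delta.
have Afe : A (conv f e) by exact: steinberg_mul.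
rewrite conv_linearl; last by case: (steinberg_row_col_finite Afe).
rewrite conv0l; apply/funext => d; rewrite addr0.
have [dx|ndx] := pselect (rng d = x); last first.
  rewrite conv_indicl0 ?mulr0; last by move=> _ -> rd; apply: ndx; rewrite -rd.
  by rewrite /e indicE_out// => dg; apply: ndx; rewrite dg.
have rcd : rng (arrow_inv c) = rng d by rewrite dx -cx.
have [sx|nsx] := pselect (src d = x); last first.
  rewrite [RHS]/e [RHS]indicE_out; last by move=> dg; apply: nsx; rewrite dg.
  rewrite (@conv_indicl _ _ _ _ _ (arrow_inv c))//; last by move=> ? ? -> ->.
  have [|_ _ t] := @arrow_mulP _ _ (arrow_inv (arrow_inv c)) d.
    by rewrite /= dx -cx.
  by rewrite fe_out ?mulr0// t.
have dE : d = arrow_unit S x.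
  by rewrite -dx; apply: aperiodic_isotropy; rewrite // dx sx.
rewrite (@conv_indicl _ _ _ _ _ (arrow_inv c))//; last by move=> ? ? -> ->.
have -> : arrow_mul (arrow_inv (arrow_inv c)) d = c.
  have -> : arrow_inv (arrow_inv c) = c.
    by apply: arrow_eq => //; rewrite !degree_inv opprK.
  have [|r dd t] := @arrow_mulP _ _ c d; first by rewrite dx cx.
  apply: arrow_eq => //; last by rewrite t sx.
  by rewrite dd dE degree_mk_arrow addr0.
by rewrite fe_in// mulVf// dE /e indicE_in.
Qed.

(** The module is spanned by the vectors e y with e the point mass at a unit,
    since the point mass at an arrow a is fixed on the right by the point mass
    at the source of a. *)
Lemma aperiodic_categorically_artinian :
  ~ (exists x, eventually_periodic S x) -> categorically_artinian R.
Proof.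
move=> ap M act hM uM fgM.
have rR := steinberg_rng K S hX.
have A0 : A 0 := subgroup0 (rng_subgroup rR).
have act0 (y : M) : act 0 y = 0.
  by apply: (addIr (act 0 y)); rewrite -(act_addl hM)// !add0r.
pose P (y : M) :=
  exists2 t, forall v, v \in t -> simple_vector act v & span act t y.
have P0 : P 0 by exists [::].
have PD (y z : M) : P y -> P z -> P (y + z).
  move=> [t simt ty] [t' simt' tz]; exists (t ++ t'); last exact: span_cat.
  by move=> v; rewrite mem_cat => /orP[/simt|/simt'].
have PN (y : M) : P y -> P (- y).
  move=> [t simt ty]; exists t => //; apply: subgroupN => //.
  by case: (span_submodule rR hM t).
have sim x (y : M) : simple_vector act (act (delta (arrow_unit S x)) y).
  have Ae := steinberg_delta (arrow_unit S x).
  move=> f Af; rewrite -(act_mul hM)//.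
  have [fe0|[g Ag gfe]] := unit_minimal x ap Af.
    by left; exact: etrans (congr1 (act^~ y) fe0) (act0 y).
  right; exists g => //; rewrite -(act_mul hM)//; last exact: (rng_mul rR).
  exact: (congr1 (fun r : rambient R => act r y) gfe).
have Pact f (y : M) : A f -> P (act f y).
  move=> /steinberg_finite_support ff; pose Q g := A g /\ P (act g y).
  suff QI g : finite_set [set c | g c <> 0] -> Q g by case: (QI f ff).
  move: g; clear f ff.
  apply: finite_support_ind; first by split=> //; rewrite act0.
  move=> k a f [Af Pf].
  have [_ AD] := steinberg_subspace K S.
  have Aka : A (fun c => k * delta a c + 0).
    by apply: AD => //; exact: steinberg_delta.
  rewrite (_ : (fun c => _) = (fun c => k * delta a c + 0) + f); last first.
    by apply/funext => c; rewrite fctE addr0.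
  split; first exact: steinberg_add.
  rewrite (act_addl hM)//; apply: PD => //.
  exists [:: act (delta (arrow_unit S (src a))) y].
    by move=> v; rewrite inE => /eqP ->; exact: sim.
  exists 0, (fun c => k * delta a c + 0); split=> //.
  have Ae := steinberg_delta (arrow_unit S (src a)).
  rewrite add0r -(act_mul hM)//; congr (act _ y).
  rewrite /= conv_linearl; last by case: (steinberg_row_col_finite Ae).
  rewrite conv0l (@conv_delta _ _ a)//.
  by apply/dr_prodE; split=> //; rewrite degree_mk_arrow addr0.
apply: (simple_span_artinian rR hM _ fgM) => y.
have : smallest (@is_subgroup M) [set z | exists f u, A f /\ z = act f u] y.
  by rewrite [smallest _ _]uM.
move=> /(_ P); apply; split; last by move=> _ [f [z [Af ->]]]; exact: Pact.
by split=> // u v Pu Pv; apply: PD => //; exact: PN.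
Qed.

End Discrete.
End Main.

Theorem proposition6p12 (K : fieldType) (X : topologicalType) (S : DRsystem X)
    (hX : totally_disconnected [set: X]) :
  [<-> discrete_space X /\ ~ (exists x : X, eventually_periodic S x);
       categorically_artinian (steinberg_algebra K (dr_groupoid S));
       locally_artinian (steinberg_algebra K (dr_groupoid S))].
Proof.
tfae.
- by move=> [dX ap]; exact: aperiodic_categorically_artinian.
- apply: categorically_locally_artinian; first exact: steinberg_rng.
  exact: steinberg_local_units.
- move=> laR; have dX := locally_artinian_discrete hX laR.
  by split=> //; exact: locally_artinian_aperiodic laR.
Qed.
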